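(* Let $G$ be a locally compact compactly generated group. For every $1\leq p<\infty$, we have $$B_{\lambda_{G,p}}(G)\geq \alpha_{G,p}.$$
   Context: **Setting.** Let $\mu$ be a left Haar measure on $G$, $S$ a compact symmetric generating subset, $|g|_S=\inf\{n\in\mathbb{N}: g\in S^n\}$ and $B(1,t)$ the ball of radius $t$ around $1$ for $|\cdot|_S$. **Cocycles and compression rate.** For an isometric (continuous linear) representation $\pi$ of $G$ on a Banach space $E$, $Z^1(G,\pi)$ is the set of continuous maps $b:G\to E$ with $b(gh)=\pi(g)b(h)+b(g)$ for all $g,h\in G$. The compression of $b$ is $\rho(t)=\inf_{|g|_S\geq t}\|b(g)\|\in[0,\infty]$. $\rho(t)\succeq t^\alpha$ means that there exists $C>0$ such that $t^\alpha=O(\rho(Ct))$ as $t\to\infty$. $B_\pi(G)$ is the supremum of all $\alpha\ge 0$ such that there exists $b\in Z^1(G,\pi)$ whose compression $\rho$ satisfies $\rho(t)\succeq t^\alpha$ (with value $0$ if there is no such $\alpha$). The left regular representation $\lambda_{G,p}$ on $L^p(G)=L^p(G,\mu)$ is $\lambda_{G,p}(g)\varphi=\varphi(g^{-1}\cdot)$. **Isoperimetric exponent.** For a function $\varphi$ on $G$ put $|\tilde{\nabla}\varphi|(g)=\sup_{s\in S}|\varphi(sg)-\varphi(g)|$, and $$J^b_{G,p}(t)=\sup_{\varphi}\frac{\|\varphi\|_p}{\|\tilde{\nabla}\varphi\|_p},$$ where the supremum is over all nonzero measurable functions $\varphi\in L^p(G,\mu)$ with support in $B(1,t)$. Define $$\alpha_{G,p}=\liminf_{t\to\infty}\frac{\log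 J^b_{G,p}(t)}{\log t}.$$ *)

(* Defs.v *)
From HB Require Import structures.
From mathcomp Require Import all_boot all_order all_algebra.
From mathcomp Require Import all_classical all_reals all_analysis.
From mathcomp Require Import measurable_realfun ess_sup_inf.

Set Implicit Arguments.
Unset Strict Implicit.
Unset Printing Implicit Defensive.

Import Order.TTheory GRing.Theory Num.Theory.
Import numFieldNormedType.Exports.

Local Open Scope classical_set_scope.
Local Open Scope ring_scope.

HB.mixin Record isTopologicalGroup G & Topological G & Group G := {
  mulg_continuous : continuous (fun x : G * G => (x.1 * x.2)%g) ;
  invg_continuous : continuous (fun x : G => x^-1%g)
}.

#[short(type="topologicalGroupType")]
HB.structure Definition TopologicalGroup :=
  {G of Topological G & Group G & isTopologicalGroup G}.

(* [measurableType] requires a distinguished point; this alias provides it. *)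
Definition pointed_group (G : topologicalGroupType) : Type := G.
HB.instance Definition _ (G : topologicalGroupType) :=
  Choice.on (pointed_group G).
HB.instance Definition _ (G : topologicalGroupType) :=
  isPointed.Build (pointed_group G) (1%g : G).

Notation borel G :=
  (g_sigma_algebraType (@open G : set (set (pointed_group G)))).

Section Generation.
Context (G : topologicalGroupType).

Definition symmetric_set (S : set G) := forall x, S x -> S (x^-1)%g.

Definition generates (S : set G) :=
  forall H : set G, H 1%g -> (forall x y, H x -> H y -> H (x * y)%g) ->
    (forall x, H x -> H (x^-1)%g) -> S `<=` H -> H = setT.

Fixpoint set_pow (S : set G) (n : nat) : set G :=
  if n is m.+1 then [set (x * y)%g | x in S & y in set_pow S m] else [set 1%g].

(* The infimum is taken in [0, +oo]; it is a natural number as soon as [S] is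
   symmetric and generates [G]. *)
Definition word_length (R : realType) (S : set G) (g : G) : \bar R :=
  ereal_inf [set (n%:R : R)%:E | n in [set n : nat | set_pow S n g]].

Definition word_ball (R : realType) (S : set G) (t : R) : set G :=
  [set g | (word_length R S g <= t%:E)%E].

End Generation.

(* A nonzero left-invariant Radon measure on the Borel sigma-algebra. *)
Record is_left_haar (R : realType) (G : topologicalGroupType)
    (mu : {measure set (borel G) -> \bar R}) : Prop := {
  haar_neq0 : mu setT != 0%E ;
  haar_left_invariant : forall (g : G) (A : set (borel G)), measurable A ->
    mu [set (g * x)%g | x in (A : set G)] = mu A ;
  haar_compact : forall K : set G, compact K -> (mu K < +oo)%E ;
  haar_outer_regular : forall A : set (borel G), measurable A ->
    mu A = ereal_inf [set mu U | U in [set U : set G | open U /\ A `<=` U]] ;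
  haar_inner_regular : forall U : set G, open U ->
    mu U = ereal_sup [set mu K | K in [set K : set G | compact K /\ K `<=` U]]
}.

(* [LspaceType mu p1] is L^p as a set of classes of real-valued measurable
   functions modulo a.e. equality; it is given here its pointwise a.e. vector
   space operations and the norm [fine (Lnorm mu p _)]. *)
Section LspaceNormed.
Context d (T : measurableType d) (R : realType).
Variables (mu : {measure set T -> \bar R}) (p : \bar R) (p1 : (1 <= p)%E).

Local Notation L := (LspaceType mu p1).
Local Notation Lf := (LfunType mu p1).

HB.instance Definition _ := gen_eqMixin L.
HB.instance Definition _ := gen_choiceMixin L.

Lemma ae_eq_Lnorm (f g : T -> R) : measurable_fun setT f ->
  measurable_fun setT g -> f = g %[ae mu] ->
  Lnorm mu p (EFin \o f) = Lnorm mu p (EFin \o g).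
Proof.
move=> mf mg fg; rewrite unlock /Lnorm.
case: p p1 => [r _|_|]; last by [].
- have mr (h : T -> R) : measurable_fun setT h ->
      measurable_fun setT (fun x => poweR (abse ((EFin \o h) x)) r).
    move=> mh; apply: (measurableT_comp (measurable_poweR r)).
    by apply: measurableT_comp => //; exact/measurable_EFinP.
  apply: (congr1 (fun z => poweR z r^-1)).
  apply: (@ge0_ae_eq_integral _ _ _ mu setT).
  + exact: measurableT.
  + exact: mr.
  + exact: mr.
  + by move=> x _; exact: poweR_ge0.
  + by move=> x _; exact: poweR_ge0.
  + by apply: filterS fg => x /= /(_ I) -> _.
- case: ifP => // _; apply: eq_ess_sup.
  by apply: filterS fg => x /= /(_ I) ->.
Qed.

Local Open Scope quotient_scope.

Lemma Lspace_measurable (F : L) : measurable_fun setT (F : T -> R).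
Proof.
have h : measurable_fun setT
    (repr (F : {mfun_ mu, T >-> measurableTypeR R}) : T -> measurableTypeR R).
  exact: measurable_funP.
move=> mT Y mY; exact: h.
Qed.

Lemma Lspace_eqP (F G : L) : (F : T -> R) = G %[ae mu] -> F = G.
Proof.
move=> FG.
have {FG} : (F : {mfun_ mu, T >-> measurableTypeR R}) = G.
  rewrite -[LHS]reprK -[RHS]reprK; apply/eqmodP; exact/asboolP.
case: F => F [[HF]]; case: G => G [[HG]] /= FG; subst G.
by rewrite (Prop_irrelevance HF HG).
Qed.

Lemma Lspace_aeP (F G : L) : {ae mu, forall x, F x = G x} -> F = G.
Proof. by move=> FG; apply: Lspace_eqP; apply: filterS FG. Qed.

Section OfLfun.
Variable f : Lf.

Lemma Lfun_measurableTypeR :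
  measurable_fun setT (f : T -> measurableTypeR R).
Proof. exact: (@measurable_funP _ _ _ _ setT f). Qed.

Definition Lfun_mfun : {mfun T >-> measurableTypeR R} :=
  HB.pack_for {mfun T >-> measurableTypeR R} (f : T -> measurableTypeR R)
    (isMeasurableFun.Build _ _ T (measurableTypeR R) f Lfun_measurableTypeR).

Definition Lspace_class : {mfun_ mu, T >-> measurableTypeR R} :=
  \pi_({mfun_ mu, T >-> measurableTypeR R}) Lfun_mfun.

Lemma Lspace_classE : (Lspace_class : T -> R) = f %[ae mu].
Proof.
have /eqmodP/asboolP : repr Lspace_class = Lfun_mfun
    %[mod {mfun_ mu, T >-> measurableTypeR R}] by exact: reprK.
exact.
Qed.

Lemma Lspace_class_finite : finite_norm mu p Lspace_class.
Proof.
rewrite /finite_norm (ae_eq_Lnorm _ _ Lspace_classE).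
- exact: Lfunction_finite.
- move=> mT Y mY; exact: (@measurable_funP _ _ _ _ setT (repr Lspace_class)).
- exact: (@measurable_funP _ _ _ _ setT f).
Qed.

HB.instance Definition _ :=
  isFinLebesgue.Build d T R mu p p1 Lspace_class Lspace_class_finite.

Definition Lspace_of : L := Lspace_class.

Lemma Lspace_of_eq : (Lspace_of : T -> R) = f %[ae mu].
Proof. exact: Lspace_classE. Qed.

Lemma Lspace_ofE : {ae mu, forall x, Lspace_of x = f x}.
Proof. by apply: filterS Lspace_of_eq => x /(_ I). Qed.

End OfLfun.


Section ToLfun.
Variable F : L.

Lemma Lspace_Lfun : (F : T -> R) \in Lfun mu p.
Proof.
rewrite inE; apply/andP; split; rewrite inE/=; first exact: Lspace_measurable.
exact: Lebesgue_finite.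
Qed.

Definition Lfun_of : Lf := Lfun_Sub p1 Lspace_Lfun.

Lemma Lfun_ofE : (Lfun_of : T -> R) = F.
Proof. by []. Qed.

End ToLfun.

Definition Lspace_zero : L := Lspace_of 0.
Definition Lspace_add (F G : L) : L := Lspace_of (Lfun_of F + Lfun_of G).
Definition Lspace_opp (F : L) : L := Lspace_of (- Lfun_of F).
Definition Lspace_scale (a : R) (F : L) : L := Lspace_of (a *: Lfun_of F).
Definition Lspace_norm (F : L) : R := fine (Lnorm mu p (EFin \o F)).

Lemma Lspace_zeroE : {ae mu, forall x, Lspace_zero x = 0}.
Proof. exact: Lspace_ofE. Qed.

Lemma Lspace_addE (F G : L) :
  {ae mu, forall x, Lspace_add F G x = F x + G x}.
Proof. exact: Lspace_ofE. Qed.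

Lemma Lspace_oppE (F : L) : {ae mu, forall x, Lspace_opp F x = - F x}.
Proof. exact: Lspace_ofE. Qed.

Lemma Lspace_scaleE (a : R) (F : L) :
  {ae mu, forall x, Lspace_scale a F x = a * F x}.
Proof. exact: Lspace_ofE. Qed.

Let ae_and (P Q : T -> Prop) : {ae mu, forall x, P x} ->
  {ae mu, forall x, Q x} -> {ae mu, forall x, P x /\ Q x}.
Proof. exact: filterI. Qed.

Lemma Lspace_addA : associative Lspace_add.
Proof.
move=> F G H; apply: Lspace_aeP.
have h1 := Lspace_addE F (Lspace_add G H).
have h2 := Lspace_addE (Lspace_add F G) H.
have h3 := ae_and (Lspace_addE F G) (Lspace_addE G H).
apply: filterS3 h1 h2 h3 => x /= e1 e2 [e3 e4].
by rewrite e1 e2 e3 e4 addrA.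
Qed.

Lemma Lspace_addC : commutative Lspace_add.
Proof.
move=> F G; apply: Lspace_aeP.
have h1 := Lspace_addE F G.
have h2 := Lspace_addE G F.
by apply: filterS2 h1 h2 => x /= e1 e2; rewrite e1 e2 addrC.
Qed.

Lemma Lspace_add0 : left_id Lspace_zero Lspace_add.
Proof.
move=> F; apply: Lspace_aeP.
have h1 := Lspace_addE Lspace_zero F.
have h2 := Lspace_zeroE.
by apply: filterS2 h1 h2 => x /= e1 e2; rewrite e1 e2 add0r.
Qed.

Lemma Lspace_addN : left_inverse Lspace_zero Lspace_opp Lspace_add.
Proof.
move=> F; apply: Lspace_aeP.
have h1 := Lspace_addE (Lspace_opp F) F.
have h2 := Lspace_oppE F.
have h3 := Lspace_zeroE.
by apply: filterS3 h1 h2 h3 => x /= e1 e2 e3; rewrite e1 e2 e3 addNr.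
Qed.

HB.instance Definition _ := GRing.isZmodule.Build L
  Lspace_addA Lspace_addC Lspace_add0 Lspace_addN.

Lemma Lspace_scaleA (a b : R) (F : L) :
  Lspace_scale a (Lspace_scale b F) = Lspace_scale (a * b) F.
Proof.
apply: Lspace_aeP.
have h1 := Lspace_scaleE a (Lspace_scale b F).
have h2 := Lspace_scaleE b F.
have h3 := Lspace_scaleE (a * b) F.
by apply: filterS3 h1 h2 h3 => x /= e1 e2 e3; rewrite e1 e2 e3 mulrA.
Qed.

Lemma Lspace_scale1 : left_id 1 Lspace_scale.
Proof.
move=> F; apply: Lspace_aeP; have h1 := Lspace_scaleE 1 F.
by apply: filterS h1 => x /= e1; rewrite e1 mul1r.
Qed.

Lemma Lspace_scaleDr : right_distributive Lspace_scale +%R.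
Proof.
move=> a F G; apply: Lspace_aeP.
have h1 := ae_and (Lspace_scaleE a (F + G)) (Lspace_addE F G).
have h2 := Lspace_addE (Lspace_scale a F) (Lspace_scale a G).
have h3 := ae_and (Lspace_scaleE a F) (Lspace_scaleE a G).
apply: filterS3 h1 h2 h3 => x /= [e1 e2] e3 [e4 e5].
by rewrite e1 e2 e3 e4 e5 mulrDr.
Qed.

Lemma Lspace_scaleDl (F : L) : {morph Lspace_scale^~ F : a b / a + b >-> a + b}.
Proof.
move=> a b; apply: Lspace_aeP.
have h1 := Lspace_scaleE (a + b) F.
have h2 := Lspace_addE (Lspace_scale a F) (Lspace_scale b F).
have h3 := ae_and (Lspace_scaleE a F) (Lspace_scaleE b F).
apply: filterS3 h1 h2 h3 => x /= e1 e2 [e3 e4].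
by rewrite e1 e2 e3 e4 mulrDl.
Qed.

HB.instance Definition _ := GRing.Zmodule_isLmodule.Build R L
  Lspace_scaleA Lspace_scale1 Lspace_scaleDr Lspace_scaleDl.

Lemma Lspace_normE (F : L) : (Lspace_norm F)%:E = Lnorm mu p (EFin \o F).
Proof. exact: (finite_norm_fine (Lfun_of F)). Qed.

Lemma Lnorm_Lspace_of (f : Lf) :
  Lnorm mu p (EFin \o Lspace_of f) = Lnorm mu p (EFin \o f).
Proof.
apply: ae_eq_Lnorm (Lspace_of_eq f); first exact: Lspace_measurable.
exact: (@measurable_funP _ _ _ _ setT f).
Qed.

Lemma Lspace_ler_normD (F G : L) :
  Lspace_norm (F + G) <= Lspace_norm F + Lspace_norm G.
Proof.
rewrite /Lspace_norm -[F + G]/(Lspace_of (Lfun_of F + Lfun_of G)).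
rewrite Lnorm_Lspace_of; exact: (ler_LnormD (Lfun_of F) (Lfun_of G)).
Qed.

Lemma Lspace_normZ (a : R) (F : L) :
  Lspace_norm (a *: F) = `|a| * Lspace_norm F.
Proof.
apply: EFin_inj; rewrite EFinM !Lspace_normE.
rewrite -[a *: F]/(Lspace_of (a *: Lfun_of F)) Lnorm_Lspace_of.
exact: (LnormZ (Lfun_of F) a).
Qed.

Lemma Lspace_norm_eq0 (F : L) : Lspace_norm F = 0 -> F = 0.
Proof.
move=> F0; apply: Lspace_aeP.
have /(filterS (fun x h => h I)) h1 :=
  @fine_Lnormr_eq0 _ _ _ mu p p1 (Lfun_of F) F0.
have h2 := Lspace_zeroE.
by apply: filterS2 h1 h2 => x /= e1 e2; rewrite e1 e2.
Qed.

HB.instance Definition _ := Lmodule_isNormed.Build R L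
  Lspace_ler_normD Lspace_normZ Lspace_norm_eq0.

End LspaceNormed.

Section LeftRegular.
Context (R : realType) (G : topologicalGroupType).
Variable mu : {measure set (borel G) -> \bar R}.
Hypothesis haar_mu : is_left_haar mu.
Variables (p : R) (p1 : (1 <= p%:E)%E).

Definition left_translate (g : G) (f : borel G -> R) : borel G -> R :=
  fun x => f (g^-1 * x : G)%g.

Let trans (g : G) : borel G -> borel G := fun x => (g^-1 * x : G)%g.

Lemma measurable_left_mulg (g : G) : measurable_fun setT (trans g).
Proof.
apply: (@measurability _ _ (borel G) (borel G) setT (trans g) (@open G)).
  by [].
move=> _ [U oU <-].
rewrite setTI; apply: sub_sigma_algebra; apply: open_comp => // x _.
apply: (@continuous_comp _ _ _ (fun x : G => (g^-1%g, x))
  (fun x : G * G => (x.1 * x.2)%g)); last exact: mulg_continuous.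
by apply: cvg_pair; [exact: cvg_cst|exact: cvg_id].
Qed.

Lemma pushforward_left_mulg (g : G) (A : set (borel G)) : measurable A ->
  pushforward mu (trans g) A = mu A.
Proof.
move=> mA; rewrite -(haar_left_invariant haar_mu g mA); congr (mu _).
apply/seteqP; split => [x /= Ax|_ [x Ax <-]].
- by exists (g^-1 * x : G)%g => //; rewrite mulVKg.
- by rewrite /= /trans mulKg.
Qed.

Lemma Lnorm_left_translate (g : G) (f : borel G -> R) : measurable_fun setT f ->
  Lnorm mu p%:E (EFin \o left_translate g f) = Lnorm mu p%:E (EFin \o f).
Proof.
move=> mf; rewrite unlock /Lnorm; apply: (congr1 (fun z => poweR z p^-1)).
pose h (x : borel G) := poweR (abse ((EFin \o f) x)) p.
have mh : measurable_fun setT h.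
  apply: (measurableT_comp (measurable_poweR p)).
  by apply: measurableT_comp => //; exact/measurable_EFinP.
have := @ge0_integral_pushforward _ _ _ _ R _ (measurable_left_mulg g) mu
  setT h measurableT mh (fun x _ => poweR_ge0 _ _).
rewrite preimage_setT => <-.
by apply: eq_measure_integral => [|? A mA _];
  [exact: measurable_left_mulg|exact: pushforward_left_mulg].
Qed.

Lemma left_translate_Lfun (g : G) (F : LspaceType mu p1) :
  left_translate g F \in Lfun mu p%:E.
Proof.
rewrite inE; apply/andP; split; rewrite inE/=.
  exact: (measurableT_comp (Lspace_measurable F) (measurable_left_mulg g)).
rewrite /finite_norm Lnorm_left_translate; first exact: Lebesgue_finite.
exact: Lspace_measurable.
Qed.

Definition left_regular (g : G) (F : LspaceType mu p1) : LspaceType mu p1 :=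
  Lspace_of (Lfun_Sub p1 (left_translate_Lfun g F)).

Lemma left_regularE (g : G) (F : LspaceType mu p1) :
  {ae mu, forall x : borel G, left_regular g F x = F (g^-1 * x : G)%g}.
Proof. exact: Lspace_ofE. Qed.

End LeftRegular.

Section Compression.
Context (R : realType) (G : topologicalGroupType) (E : normedModType R).
Local Open Scope ereal_scope.

Definition cocycle (pi : G -> E -> E) (b : G -> E) :=
  continuous b /\ forall g h, b (g * h)%g = (pi g (b h) + b g)%R.

Definition compression (S : set G) (b : G -> E) (t : R) : \bar R :=
  ereal_inf [set `|b g|%:E | g in [set g | t%:E <= word_length R S g]].

Definition dominates_power (rho : R -> \bar R) (a : R) :=
  exists2 C : R, (0 < C)%R & exists2 K : R, (0 < K)%R &
    \forall t \near +oo%R, (t `^ a)%:E <= K%:E * rho (C * t)%R.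

(* Adjoining [0] to the set of exponents gives the value [0] when there is
   none, and does not change the supremum otherwise. *)
Definition compression_exponent (S : set G) (pi : G -> E -> E) : \bar R :=
  ereal_sup (0 |` [set a%:E | a in [set a : R | (0 <= a)%R /\
    exists2 b : G -> E, cocycle pi b & dominates_power (compression S b) a]]).

End Compression.

Section Isoperimetry.
Context (R : realType) (G : topologicalGroupType).
Variable mu : {measure set (borel G) -> \bar R}.
Local Open Scope ereal_scope.

(* The supremum is taken in [0, +oo], so that it is [0] if [S] is empty. *)
Definition left_gradient (S : set G) (f : borel G -> R) : borel G -> \bar R :=
  fun g => ereal_sup
    (0 |` [set `|f (s * g : G)%g - f g|%R%:E | s in S]).

(* In [\bar R], [x / 0 = +oo] and [r%:E / +oo = 0] for [0 < x].  Functions are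
   nonzero as elements of L^p.  If [left_gradient S f] is not measurable, the
   integral in its norm is the lower one (supremum over the simple functions
   below), so that it is still at least the norm of [f (s * x) - f x] for each
   [s] in [S]. *)
Definition isop_profile (S : set G) (p t : R) : \bar R :=
  ereal_sup [set Lnorm mu p%:E (EFin \o f) / Lnorm mu p%:E (left_gradient S f) |
    f in [set f : borel G -> R | [/\ f \in Lfun mu p%:E,
      Lnorm mu p%:E (EFin \o f) != 0 &
      closure [set x : G | f x != 0%R] `<=` word_ball S t]]].

Definition isop_exponent (S : set G) (p : R) : \bar R :=
  limf_einf (fun t : R => lne (isop_profile S p t) / (ln t)%:E) +oo%R.

End Isoperimetry.

(* Main.v *)
Require Import Defs.
From HB Require Import structures.
From mathcomp Require Import all_boot all_order all_algebra.
From mathcomp Require Import all_classical all_reals all_analysis.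
From mathcomp Require Import measurable_realfun ring lra zify.

Set Implicit Arguments.
Unset Strict Implicit.
Unset Printing Implicit Defensive.

Import Order.TTheory GRing.Theory Num.Theory.
Import numFieldNormedType.Exports.

Local Open Scope classical_set_scope.
Local Open Scope ring_scope.

(**
  Fix [0 <= al < be < alpha_{G,p}]. For every large [t = 2^k] there is a function
  supported in [B(1,t)] whose L^p norm is [t^al] while its left gradient has norm
  at most [t^(al - be)], a summable quantity. Right translations commute with the
  left regular representation, so these functions can be moved to balls
  [B(1,2^k) h_k] that are very far apart without spoiling either estimate; here
  one uses that right translations multiply the left Haar measure by a constant.
  Let [f] be the sum of the translated functions and [b(g) = f(g^-1 .) - f]. By
  Fatou's lemma [b(g)] is in L^p even if [f] is not, and [b] is a cocycle. If
  [|g|] is between [2 * 2^k] and [4 * 2^k], then on the support of the k-th function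
  [f(g^-1 .)] vanishes and all other terms of [f] vanish too, so there is no
  cancellation and the norm of [b(g)] is at least [2^(k * al)].

  The constant for right translations comes from computing the integral of
  [f(x) g(y x)] over [G x G] in two ways, for continuous compactly supported [f]
  and [g], and from the regularity of the measure. Multiplication on [G x G] need
  not be measurable for the product of the Borel sigma-algebras when [G] is not
  second countable, which is why Fubini's theorem is only used for continuous
  functions.
*)

(** * Topological groups and word length *)

Section GroupTopology.
Context (G : topologicalGroupType).
Implicit Types (x y a : G) (K L U : set G).

Lemma continuous_mulgl a : continuous (fun x : G => (a * x)%g).
Proof.
move=> x; apply: (@continuous_comp _ _ _ (fun x : G => (a, x))
  (fun z : G * G => (z.1 * z.2)%g)); last exact: mulg_continuous.
by apply: cvg_pair; [exact: cvg_cst|exact: cvg_id].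
Qed.

Lemma continuous_mulgr a : continuous (fun x : G => (x * a)%g).
Proof.
move=> x; apply: (@continuous_comp _ _ _ (fun x : G => (x, a))
  (fun z : G * G => (z.1 * z.2)%g)); last exact: mulg_continuous.
by apply: cvg_pair; [exact: cvg_id|exact: cvg_cst].
Qed.

Lemma mulgl_image a K : [set (a * x)%g | x in K] = (fun x =>
  (a^-1 * x)%g) @^-1` K.
Proof.
apply/seteqP; split => [_ [x Kx <-]|x /= Kx]; first by rewrite /= mulKg.
by exists (a^-1 * x)%g => //; rewrite mulVKg.
Qed.

Lemma mulgr_image a K : [set (x * a)%g | x in K] = (fun x =>
  (x * a^-1)%g) @^-1` K.
Proof.
apply/seteqP; split => [_ [x Kx <-]|x /= Kx]; first by rewrite /= mulgK.
by exists (x * a^-1)%g => //; rewrite mulgVK.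
Qed.

Lemma compact_mulgr a K : compact K -> compact [set (x * a)%g | x in K].
Proof.
move=> cK; apply: continuous_compact => //.
by apply: continuous_subspaceT; exact: continuous_mulgr.
Qed.

Lemma compact_mulg K L : compact K -> compact L ->
  compact [set (x * y)%g | x in K & y in L].
Proof.
move=> cK cL.
have -> : [set (x * y)%g | x in K & y in L] =
    (fun z : G * G => (z.1 * z.2)%g) @` (K `*` L).
  apply/seteqP; split => [_ [x Kx [y Ly <-]]|_ [[x y] [Kx Ly] <-]].
    by exists (x, y).
  by exists x => //; exists y.
apply: continuous_compact; last exact: compact_setX.
by apply: continuous_subspaceT; exact: mulg_continuous.
Qed.

Lemma compact_invg K : compact K -> compact [set x^-1%g | x in K].
Proof.
move=> cK; apply: continuous_compact => //.
by apply: continuous_subspaceT; exact: invg_continuous.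
Qed.

Lemma compact_set_pow K n : compact K -> compact (set_pow K n).
Proof.
move=> cK; elim: n => [|n IH] /=; first exact: compact_set1.
exact: compact_mulg.
Qed.

Lemma open_mulgl a U : open U -> open [set (a * x)%g | x in U].
Proof.
by move=> oU; rewrite mulgl_image; apply: open_comp => // x _;
  exact: continuous_mulgl.
Qed.

Lemma open_mulgr a U : open U -> open [set (x * a)%g | x in U].
Proof.
by move=> oU; rewrite mulgr_image; apply: open_comp => // x _;
  exact: continuous_mulgr.
Qed.

Lemma borel_continuous (H : topologicalGroupType) (f : G -> H) : continuous f ->
  measurable_fun setT (f : borel G -> borel H).
Proof.
move=> cf.
apply: (@measurability _ _ (borel G) (borel H) setT f (@open H)) => //.
move=> _ [U oU <-].
by rewrite setTI; apply: sub_sigma_algebra; apply: open_comp => // x _;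
  exact: cf.
Qed.

Lemma borel_open U : open U -> measurable (U : set (borel G)).
Proof. by move=> oU; exact: sub_sigma_algebra. Qed.

Lemma borel_compact K : hausdorff_space G -> compact K ->
  measurable (K : set (borel G)).
Proof.
move=> hG cK; rewrite -[K]setCK; apply: measurableC; apply: borel_open.
by rewrite openC; exact: compact_closed.
Qed.

Lemma locally_compact_nbhs : locally_compact [set: G] -> forall x : G,
  exists2 K : set G, compact K & nbhs x K.
Proof.
move=> lG x; have [B nB [cB clB]] := lG x I.
exists B => //.
have nB' : \forall y \near x, setT y -> B y := nB.
by near=> y; have := near nB' y; apply.
Unshelve. all: by end_near. Qed.

End GroupTopology.

Section WordLength.
Context (G : topologicalGroupType) (S : set G).
Hypotheses (symmetric_S : symmetric_set S) (generates_S : generates S).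
Implicit Types x y : G.

Lemma set_powD m n x y : set_pow S m x -> set_pow S n y ->
  set_pow S (m + n) (x * y)%g.
Proof.
elim: m x => [|m IH] x /=; first by move=> ->; rewrite mul1g.
move=> [s Ss [z Sz <-]] Sy; exists s => //.
by exists (z * y)%g; [exact: IH|rewrite mulgA].
Qed.

Lemma set_pow1 x : S x -> set_pow S 1 x.
Proof. by move=> Sx; exists x => //; exists 1%g => //; rewrite mulg1. Qed.

Lemma set_powV n x : set_pow S n x -> set_pow S n x^-1%g.
Proof.
elim: n x => [|n IH] x /=; first by move=> ->; rewrite /= invg1.
move=> [s Ss [z Sz <-]]; rewrite invgM.
by have := set_powD (IH _ Sz) (set_pow1 (symmetric_S Ss)); rewrite addn1.
Qed.

Lemma set_pow_cover x : exists n, set_pow S n x.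
Proof.
suff /seteqP[_ /(_ x I)//] : [set x | exists n, set_pow S n x] = setT.
apply: generates_S => [|y z [m Hy] [n Hz]|y [n Hy]|y Sy] /=.
- by exists 0%N.
- by exists (m + n)%N; exact: set_powD.
- by exists n; exact: set_powV.
- by exists 1%N; exact: set_pow1.
Qed.

Definition wlength x : nat :=
  ex_minn (let: ex_intro n Hn := set_pow_cover x in
    ex_intro (fun n => `[< set_pow S n x >]) n (asboolT Hn)).

Lemma wlengthP x : set_pow S (wlength x) x.
Proof. by rewrite /wlength; case: ex_minnP => m /asboolP. Qed.

Lemma wlength_le n x : set_pow S n x -> (wlength x <= n)%N.
Proof.
by move=> Hn; rewrite /wlength; case: ex_minnP => m _; apply; exact/asboolP.
Qed.

Lemma wlength1 : wlength 1%g = 0%N.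
Proof. by apply/eqP; rewrite -leqn0; exact: wlength_le. Qed.

Lemma wlengthM x y : (wlength (x * y)%g <= wlength x + wlength y)%N.
Proof. by apply: wlength_le; apply: set_powD; exact: wlengthP. Qed.

Lemma wlengthV x : wlength x^-1%g = wlength x.
Proof.
suff h y : (wlength y^-1%g <= wlength y)%N.
  by apply/eqP; rewrite eqn_leq h /= -{1}[x]invgK h.
by apply: wlength_le; apply: set_powV; exact: wlengthP.
Qed.

Lemma word_lengthE (R : realType) x :
  word_length R S x = ((wlength x)%:R : R)%:E.
Proof.
apply/eqP; rewrite eq_le; apply/andP; split.
  by apply: ereal_inf_lbound; exists (wlength x) => //; exact: wlengthP.
apply: le_ereal_inf_tmp => _ [n /= Hn <-].
by rewrite lee_fin ler_nat; exact: wlength_le.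
Qed.

End WordLength.

(** * Continuous functions on the square of a sigma-compact group *)

Definition compact_exhaustion (G : topologicalType) :=
  exists2 K : nat -> set G, (forall n, compact (K n)) & \bigcup_n K n = setT.

Lemma generated_compact_exhaustion (G : topologicalGroupType) (S : set G) :
  compact S -> symmetric_set S -> generates S -> compact_exhaustion G.
Proof.
move=> cS symS genS; exists (set_pow S); first by move=> n;
  exact: compact_set_pow.
by apply/seteqP; split => // x _; have [n] := set_pow_cover symS genS x;
  exists n.
Qed.

Section ProductMeasurability.
Context (R : realType) (G : topologicalGroupType).

(** Finitely many open rectangles inside [V] cover [C]; their union is measurable for the product of
    the Borel sigma-algebras, while [V] itself need not be. *)
Lemma compact_sub_measurable_rectangles (C V : set (G * G)) :
  compact C -> open V -> C `<=` V ->
  exists M : set (G * G),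
    [/\ measurable (M : set (borel G * borel G)), C `<=` M & M `<=` V].
Proof.
move=> /compact_near_coveringP cC oV CV.
pose D : set (set (G * G)) :=
  [set M | measurable (M : set (borel G * borel G)) /\ M `<=` V].
(* [F] is the filter of all large enough members of [D]. As [D] is stable under finite unions,
   compactness along [F] does the work of a finite subcover. *)
pose F : set_system (set (G * G)) :=
  filter_from D (fun M => [set M' | D M' /\ M `<=` M']).
have FF : Filter F.
  apply: filter_from_filter; first by exists set0; split => //;
    exact: measurable0.
  move=> M N [mM MV] [mN NV]; exists (M `|` N).
    by split; [exact: measurableU|rewrite subUset].
  by move=> M' [DM']; rewrite subUset => -[? ?].
have [z Cz|M [mM MV] MC] := cC _ F (fun M z => M z) FF.
  have : nbhs z V by apply: open_nbhs_nbhs; split => //; exact: CV.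
  case=> -[A B] [/= nA nB] ABV.
  exists (interior A `*` interior B, [set M' | D M' /\ interior A `*` interior
    B `<=` M']).
    split => /=; first by exists (interior A, interior B) => //; split;
      exact: nbhs_interior.
    exists (interior A `*` interior B) => //; split.
      by apply: measurableX; apply: borel_open; exact: open_interior.
    by move=> [x y] [/= /interior_subset Ax /interior_subset By]; exact: ABV.
  by move=> [z' M'] [/= z'AB [_]]; apply.
by exists M; split => //; apply: (MC M); split => //; split.
Qed.

(** Countably many compact pieces exhaust each set [F > c], and each piece is enlarged within it to
    a measurable set. *)
Lemma measurable_continuous_prod (F : G * G -> R) : compact_exhaustion G ->
  continuous F -> measurable_fun setT (F : borel G * borel G -> R).
Proof.
move=> [K cK KT] cF.
apply: (measurability _ (RGenOInfty.measurableE R)) => // _ [_ [c ->] <-].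
rewrite setTI; pose V := F @^-1` `]c, +oo[.
have oV : open V by apply: open_comp; [move=> x _;
  exact: cF|exact: interval_open].
(* The margin above [c] makes the condition closed, hence the piece compact; it shrinks to [0], so
   that no point of [V] is lost. *)
pose C i := (K i.1.1 `*` K i.1.2) `&` F @^-1` `[c + i.2.+1%:R^-1, +oo[.
have cC i : compact (C i).
  apply: compact_closedI; first exact: compact_setX.
  by apply: closed_comp; [move=> x _; exact: cF|exact: interval_closed].
have CV i : C i `<=` V.
  move=> z [_]; rewrite /= /V /= !in_itv/= !andbT; apply: lt_le_trans.
  by rewrite ltrDl invr_gt0.
have /choice[M HM] : forall i, exists M : set (G * G),
    [/\ measurable (M : set (borel G * borel G)), C i `<=` M & M `<=` V].
  by move=> i; exact: compact_sub_measurable_rectangles.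
have -> : F @^-1` `]c, +oo[ = \bigcup_n \bigcup_k \bigcup_m M (n, k, m).
  apply/seteqP; split => [[x y] Vz|z [n _ [k _ [m _ Mz]]]]; last first.
    by have [_ _] := HM (n, k, m); exact.
  have [n _ Kn] : (\bigcup_n K n) x by rewrite KT.
  have [k _ Kk] : (\bigcup_n K n) y by rewrite KT.
  move: (Vz); rewrite /= in_itv/= andbT -subr_gt0 => /ltr_add_invr[m].
  rewrite add0r => Hm; exists n => //; exists k => //; exists m => //.
  have [_ + _] := HM (n, k, m); apply; split => //.
  by rewrite /= in_itv/= andbT -lerBrDl ltW.
apply: bigcupT_measurable => n; apply: bigcupT_measurable => k.
by apply: bigcupT_measurable => m; have [] := HM (n, k, m).
Qed.

End ProductMeasurability.

(** Urysohn's lemma in the one-point compactification, which is compact Hausdorff and hence normal.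
    Shrinking [U] to the interior of a compact neighbourhood of [K] yields the compact support. *)
Lemma urysohn_compact (R : realType) (G : topologicalGroupType) (K U : set G) :
  hausdorff_space G -> locally_compact [set: G] -> compact K -> open U ->
  K `<=` U ->
  exists f : G -> R, [/\ continuous f, forall x, 0 <= f x <= 1,
    forall x, K x -> f x = 1, forall x, ~ U x -> f x = 0 &
    exists2 M : set G, compact M & forall x, ~ M x -> f x = 0].
Proof.
move=> hG lG cK oU KU.
have [V cV nV] := locally_compact_nbhs lG (1%g : G).
pose M := [set (x * y)%g | x in K & y in V].
have cM : compact M by exact: compact_mulg.
have KM : K `<=` interior M.
  move=> k Kk; rewrite /interior /=.
  have : nbhs k ((fun x => (k^-1 * x)%g) @^-1` V).
    by apply: continuous_mulgl; rewrite mulVg.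
  apply: filterS => x Vx; exists k => //; exists (k^-1 * x)%g => //.
  by rewrite mulVKg.
pose W := U `&` interior M.
have oW : open W by apply: openI => //; exact: open_interior.
pose opc := one_point_compactification G.
have normal_opc : normal_space opc.
  apply: compact_normal; last exact: one_point_compactification_compact.
  exact: one_point_compactification_hausdorff.
pose A : set opc := Some @` K.
pose B : set opc := ~` (Some @` W).
have clA : closed A.
  apply: compact_closed; first exact: one_point_compactification_hausdorff.
  apply: continuous_compact => //; apply: continuous_subspaceT.
  exact: one_point_compactification_some_continuous.
have clB : closed B.
  by apply: open_closedC; exact: one_point_compactification_open_some.
have AB : A `&` B = set0.
  rewrite -subset0 => _ [[x Kx <-]]; apply; exists x => //.
  by split; [exact: KU|exact: KM].
have /(@uniform_separatorP _ R)[g [cg g01 gA gB]] :=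
  (@normal_separatorP R _).1 normal_opc A B clA clB AB.
have g0 x : ~ W x -> g (Some x) = 1.
  move=> nWx; have /gB : (g @` B) (g (Some x)); last exact.
  by exists (Some x) => // -[y Wy [yx]]; apply: nWx; rewrite -yx.
exists (fun x => 1 - g (Some x)); split.
- move=> x; apply: continuousB; first exact: cvg_cst.
  apply: (@continuous_comp _ _ _ (Some : G -> opc) g); last exact: cg.
  exact: one_point_compactification_some_continuous.
- move=> x; have : (range g) (g (Some x)) by exists (Some x).
  by move=> /g01; rewrite /= in_itv/= => /andP[? ?];
    rewrite subr_ge0 lerBlDr lerDl; apply/andP.
- move=> x Kx; have /gA -> : (g @` A) (g (Some x)) by exists (Some x) => //;
    exists x.
  by rewrite subr0.
- by move=> x nUx; rewrite g0 ?subrr// => -[].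
- exists M => // x nMx; rewrite g0 ?subrr// => -[_ /interior_subset].
  exact: nMx.
Qed.

(** * Right translations of the Haar measure *)

Lemma sigma_finite_Fubini d (T : measurableType d) (R : realType)
    (mu : {measure set T -> \bar R}) (f : T * T -> \bar R) :
  sigma_finite setT mu -> measurable_fun setT f -> (forall z, (0 <= f z)%E) ->
  (\int[mu]_x \int[mu]_y f (x, y) = \int[mu]_y \int[mu]_x f (x, y))%E.
Proof.
move=> sf mf f0.
pose H1 := isSFinite.Build _ _ _ (Measure.sort mu)
  (sfinite_measure_sigma_finite sf).
pose m := HB.pack_for (SFiniteMeasure.type T R) (Measure.sort mu) H1.
exact: (sfinite_Fubini m m).
Qed.

(** * Positivity on open sets and Fubini's theorem for the Haar measure *)

Section Haar.
Context (R : realType) (G : topologicalGroupType).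
Hypotheses (hausdorff_G : hausdorff_space G).
Hypotheses (locally_compact_G : locally_compact [set: G]).
Hypotheses (exhaustion_G : compact_exhaustion G).
Context (mu : {measure set (borel G) -> \bar R}).
Hypothesis haar_mu : is_left_haar mu.
Implicit Types (K U : set G) (f g : G -> R).
Local Open Scope ereal_scope.

(** If [U] were null, finitely many of its translates would cover any compact set, which would be
    null too; inner regularity would then make the whole group null. *)
Lemma haar_open_gt0 U : open U -> U !=set0 -> 0 < mu U.
Proof.
move=> oU [u Uu]; rewrite lt0e measure_ge0 andbT; apply/eqP => U0.
have muK K : compact K -> mu K = 0.
  move=> cK; pose D : set (set G) := [set M | open M /\ mu M = 0].
  pose F : set_system (set G) := filter_from D (fun M =>
    [set M' | D M' /\ M `<=` M']).
  have FF : Filter F.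
    apply: filter_from_filter; first by exists set0; split;
      [exact: open0|exact: measure0].
    move=> M N [oM M0] [oN N0]; exists (M `|` N).
      split; first exact: openU.
      apply/eqP; rewrite -measure_le0; apply: (le_trans (measureU2 _ _ _)).
      - exact: borel_open.
      - exact: borel_open.
      - by apply: adde_le0; rewrite measure_le0; apply/eqP.
    by move=> M' [DM']; rewrite subUset => -[? ?].
  move/compact_near_coveringP: cK (cK) => ncK cK.
  have [z Kz|M [oM M0] MC] := ncK _ F (fun M z => M z) FF.
    pose V := [set (z * u^-1 * x)%g | x in U].
    have oV : open V by exact: open_mulgl.
    exists (V, [set M' | D M' /\ V `<=` M']);
      last by move=> [z' M'] [/= z'V [_]]; apply.
    split => /=.
      by apply: open_nbhs_nbhs; split => //; exists u => //; rewrite mulgVK.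
    exists V => //; split => //.
    by rewrite (haar_left_invariant haar_mu) //; exact: borel_open.
  apply/eqP; rewrite -measure_le0 -M0; apply: le_measure; rewrite ?inE.
  - exact: borel_compact.
  - exact: borel_open.
  - by apply: (MC M); split.
have := haar_neq0 haar_mu; rewrite (haar_inner_regular haar_mu);
  last exact: openT.
move=> /eqP; apply; apply/eqP; rewrite eq_le; apply/andP; split.
  by apply: ge_ereal_sup => _ [K [cK _] <-]; rewrite muK.
apply: ereal_sup_ubound; exists set0; last exact: measure0.
by split; [exact: compact0|exact: sub0set].
Qed.

Lemma haar_sigma_finite : sigma_finite setT mu.
Proof.
have [K cK KT] := exhaustion_G; exists K; first by rewrite KT.
move=> n; split; first exact: borel_compact.
exact: (haar_compact haar_mu).
Qed.

Lemma haar_integral_mulgl (a : G) (F : borel G -> \bar R) :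
  measurable_fun setT F -> (forall x, 0 <= F x) ->
  \int[mu]_x F (a * x : G)%g = \int[mu]_x F x.
Proof.
move=> mF F0.
move: a; suff h b : \int[mu]_x F (b^-1 * x : G)%g = \int[mu]_x F x.
  by move=> a; rewrite -[in RHS](h a^-1%g) invgK.
have := @ge0_integral_pushforward _ _ _ _ R _ (measurable_left_mulg b) mu
  setT F measurableT mF (fun x _ => F0 x).
rewrite preimage_setT => <-.
by apply: eq_measure_integral => [|? A mA _];
  [exact: measurable_left_mulg|exact: pushforward_left_mulg].
Qed.

Lemma haar_Fubini (F : G * G -> R) : continuous F -> (forall z, (0 <= F z)%R) ->
  \int[mu]_x \int[mu]_y (F (x, y))%:E = \int[mu]_y \int[mu]_x (F (x, y))%:E.
Proof.
move=> cF F0.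
apply: (@sigma_finite_Fubini _ (borel G) R mu (fun z => (F z)%:E)).
- exact: haar_sigma_finite.
- by apply/measurable_EFinP; exact: measurable_continuous_prod.
- by move=> z; rewrite lee_fin.
Qed.

Lemma borel_continuous_real f : continuous f -> measurable_fun setT (f :
  borel G -> R).
Proof.
move=> cf; apply: (measurability _ (RGenOInfty.measurableE R)) =>
  // _ [_ [c ->] <-].
rewrite setTI; apply: borel_open.
by apply: open_comp; [move=> x _; exact: cf|exact: interval_open].
Qed.

End Haar.

(** * Integrals of right translates of compactly supported functions *)

Section Modular.
Context (R : realType) (G : topologicalGroupType).
Hypotheses (hausdorff_G : hausdorff_space G).
Hypotheses (locally_compact_G : locally_compact [set: G]).
Hypotheses (exhaustion_G : compact_exhaustion G).
Context (mu : {measure set (borel G) -> \bar R}).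
Hypothesis haar_mu : is_left_haar mu.
Implicit Types (K U : set G) (f g : G -> R) (x y : G).

Definition bump f := [/\ continuous f, forall x, 0 <= f x <= 1 &
  exists2 M : set G, compact M & forall x, ~ M x -> f x = 0].

Lemma bump_ge0 f x : bump f -> 0 <= f x.
Proof. by move=> [_ /(_ x)/andP[]]. Qed.

Lemma bump_mulgr f x : bump f -> bump (fun y => f (y * x)%g).
Proof.
move=> [cf f01 [M cM fM]]; split => //.
  move=> y; apply: (@continuous_comp _ _ _ (fun y : G => (y * x)%g) f);
    last exact: cf.
  exact: continuous_mulgr.
exists [set (y * x^-1)%g | y in M]; first exact: compact_mulgr.
by move=> y nMy; apply: fM => Myx; apply: nMy; exists (y * x)%g => //;
  rewrite mulgK.
Qed.

(** By [rint_ratio] the dependence on [x] is through a factor common to all bump functions: the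
    modular function at [x] or at its inverse, according to convention. *)
Definition rint f x : R := fine (\int[mu]_y (f (y * x)%g)%:E)%E.

Local Open Scope ereal_scope.

Lemma bump_integral_fin f : bump f -> \int[mu]_x (f x)%:E \is a fin_num.
Proof.
move=> [cf f01 [M cM fM]]; rewrite ge0_fin_numE; last first.
  by apply: integral_ge0 => x _; rewrite lee_fin; case/andP: (f01 x).
have mM : measurable (M : set (borel G)) by exact: borel_compact.
apply: (@le_lt_trans _ _ (\int[mu]_x (\1_M x)%:E)); last first.
  by rewrite integral_indic// setIT; exact: (haar_compact haar_mu).
apply: ge0_le_integral => //=.
- by move=> x _; rewrite lee_fin; case/andP: (f01 x).
- by apply/measurable_EFinP; exact: borel_continuous_real.
- by apply/measurable_EFinP; exact: measurable_indic.
- move=> x _; rewrite lee_fin indicE; have [Mx|nMx] := pselect (M x).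
    by rewrite mem_set//; case/andP: (f01 x).
  by rewrite (fM x nMx) ler0n.
Qed.

Lemma rintE f x : bump f -> (rint f x)%:E = \int[mu]_y (f (y * x : G)%g)%:E.
Proof. by move=> bf; rewrite /rint fineK//; apply: bump_integral_fin;
  exact: bump_mulgr. Qed.

Lemma rint_ge0 f x : bump f -> (0 <= rint f x)%R.
Proof.
by move=> bf; apply: fine_ge0; apply: integral_ge0 => y _;
  rewrite lee_fin bump_ge0.
Qed.

Lemma continuous_integral_gt0 f x : continuous f -> (forall y, 0 <= f y)%R ->
  (0 < f x)%R -> 0 < \int[mu]_y (f y)%:E.
Proof.
move=> cf f0 fx; pose c := (f x / 2)%R.
pose U := f @^-1` `]c, +oo[.
have oU : open U by apply: open_comp; [move=> y _;
  exact: cf|exact: interval_open].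
have mU : measurable (U : set (borel G)) by exact: borel_open.
have U0 : 0 < mu U.
  apply: (haar_open_gt0 hausdorff_G haar_mu) => //; exists x.
  by rewrite /U /= in_itv/= andbT /c ltr_pdivrMr// ltr_pMr// ltr1n.
have c0 : (0 < c)%R by rewrite divr_gt0.
apply: (@lt_le_trans _ _ (\int[mu]_y (c%:E * (\1_U y)%:E))); last first.
  apply: ge0_le_integral => //=.
  - by move=> y _; rewrite mule_ge0// lee_fin// ltW.
  - by apply: emeasurable_funM => //; apply/measurable_EFinP;
      exact: measurable_indic.
  - by apply/measurable_EFinP; exact: borel_continuous_real.
  - move=> y _; rewrite -EFinM lee_fin indicE; have [Uy|nUy] := pselect (U y).
      by rewrite mem_set// mulr1; move: Uy; rewrite /U /= in_itv/= andbT;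
        exact: ltW.
    by rewrite memNset// mulr0.
rewrite ge0_integralZl//=; last 2 first.
- by apply/measurable_EFinP; exact: measurable_indic.
- by rewrite lee_fin ltW.
by rewrite integral_indic// setIT mule_gt0.
Qed.

(** While [x] stays in a compact neighbourhood [W] of [x0], the functions [f (y * x)] of [y] all
    vanish outside one compact set [N], of finite measure, and on [N] they converge uniformly as [x]
    tends to [x0]. *)
Lemma continuous_rint f : bump f -> continuous (rint f).
Proof.
move=> bf x0; have [cf f01 [M cM fM]] := bf.
have [W cW nW] := locally_compact_nbhs locally_compact_G x0.
pose N := [set (y * z)%g | y in M & z in [set w^-1%g | w in W]].
have cN : compact N by apply: compact_mulg => //; exact: compact_invg.
have mN : measurable (N : set (borel G)) by exact: borel_compact.
have Nfin : mu N \is a fin_num.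
  by rewrite ge0_fin_numE//; exact: (haar_compact haar_mu).
apply/cvgrPdist_le => e e0.
(* The [+ 1] guards against [mu N = 0]. *)
pose d := (e / (fine (mu N) + 1))%R.
have N1 : (0 < fine (mu N) + 1)%R by rewrite ltr_wpDl// fine_ge0.
have d0 : (0 < d)%R by rewrite divr_gt0.
have dN : (d * fine (mu N) <= e)%R.
  by rewrite /d mulrAC ler_pdivrMr// ler_pM2l// lerDl.
(* Joint continuity at each [(y, x0)] and compactness of [N] give one neighbourhood of [x0] that
   serves all [y] in [N]. *)
have unif : \forall x \near x0, N `<=` (fun y =>
  `|f (y * x0)%g - f (y * x)%g| < d)%R.
  move/compact_near_coveringP: cN; apply => y Ny.
  have : continuous (fun z : G * G => f (z.1 * x0)%g - f (z.1 * z.2)%g)%R.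
    move=> z; apply: continuousB.
      apply: (@continuous_comp _ _ _ (fun z : G * G => (z.1 * x0)%g) f);
        last exact: cf.
      apply: (@continuous_comp _ _ _ (fun z :
        G * G => z.1) (fun y => (y * x0)%g)).
        exact: cvg_fst.
      exact: continuous_mulgr.
    apply: (@continuous_comp _ _ _ (fun z : G * G => (z.1 * z.2)%g) f);
      last exact: cf.
    exact: mulg_continuous.
  move=> /(_ (y, x0))/cvgrPdist_lt/(_ d d0) /=.
  rewrite subrr; apply: filterS => -[y' x] /=.
  by rewrite sub0r normrN.
have bound (a b : G) : W a -> W b ->
    N `<=` (fun y => `|f (y * a)%g - f (y * b)%g| < d)%R ->
      (rint f a <= rint f b + e)%R.
  move=> Wa Wb Nab; rewrite -lee_fin EFinD !rintE//.
  apply: (@le_trans _ _ (\int[mu]_y ((f (y * b)%g)%:E + (d%:E * (\1_N y)%:E)))).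
    apply: ge0_le_integral => //=.
    - by move=> y _; rewrite lee_fin bump_ge0.
    - apply/measurable_EFinP; apply: borel_continuous_real.
      by have [] := bump_mulgr a bf.
    - apply: emeasurable_funD.
        by apply/measurable_EFinP; apply: borel_continuous_real;
          have [] := bump_mulgr b bf.
      by apply: emeasurable_funM => //; apply/measurable_EFinP;
        exact: measurable_indic.
    - move=> y _; rewrite -EFinM -EFinD lee_fin indicE;
        have [Ny|nNy] := pselect (N y).
        rewrite mem_set// mulr1; have /ltW := Nab y Ny.
        by move=> /(le_trans (ler_norm _)); rewrite lerBlDl.
      have -> : f (y * a)%g = 0%R.
        apply: fM => Mya; apply: nNy; exists (y * a)%g => //; exists a^-1%g;
          first by exists a.
        by rewrite mulgK.
      by rewrite memNset// mulr0 addr0 bump_ge0.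
  rewrite ge0_integralD//=; last 4 first.
  - by move=> y _; rewrite lee_fin bump_ge0.
  - by apply/measurable_EFinP; apply: borel_continuous_real;
      have [] := bump_mulgr b bf.
  - by move=> y _; rewrite mule_ge0// lee_fin// ltW.
  - by apply: emeasurable_funM => //; apply/measurable_EFinP;
      exact: measurable_indic.
  rewrite leeD2l// ge0_integralZl//=; last 2 first.
  - by apply/measurable_EFinP; exact: measurable_indic.
  - by rewrite lee_fin ltW.
  by rewrite integral_indic// setIT -(fineK Nfin) -EFinM lee_fin.
have Wx0 : W x0 by exact: nbhs_singleton.
near=> x; have Wx : W x by near: x.
have xu : N `<=` (fun y => `|f (y * x0)%g - f (y * x)%g| < d)%R by near: x.
have h1 := bound _ _ Wx0 Wx xu.
have h2 : (rint f x <= rint f x0 + e)%R.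
  by apply: bound => // y /xu; rewrite distrC.
by rewrite ler_norml; apply/andP; split; lra.
Unshelve. all: by end_near. Qed.

End Modular.

(** * Proportionality of right-translated integrals *)

Section ModularFunction.
Context (R : realType) (G : topologicalGroupType).
Hypotheses (hausdorff_G : hausdorff_space G).
Hypotheses (locally_compact_G : locally_compact [set: G]).
Hypotheses (exhaustion_G : compact_exhaustion G).
Context (mu : {measure set (borel G) -> \bar R}).
Hypothesis haar_mu : is_left_haar mu.
Implicit Types (K U : set G) (f g : G -> R) (x y : G).
Local Open Scope ereal_scope.
Local Notation rint := (rint mu).
Local Notation rintE := (rintE hausdorff_G haar_mu).

Let mEFin (f : G -> R) : continuous f ->
  measurable_fun setT (fun x : borel G => (f x)%:E).
Proof. by move=> cf; apply/measurable_EFinP; exact: borel_continuous_real. Qed.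

(* Left invariance and Tonelli allow to replace [x] by [y^-1 * x] and then [y]
   by [x * y] in the double integral of [f x * g (y * x)]. *)
Lemma haar_twist f g : bump f -> bump g ->
  \int[mu]_x (f x * rint g x)%:E = \int[mu]_y (f y^-1%g)%:E * (rint g 1%g)%:E.
Proof.
move=> bf bg; have [cf _ _] := bf; have [cg _ _] := bg.
have cdiv : continuous (fun z : G * G => f (z.2^-1 * z.1)%g).
  move=> z.
  apply: (@continuous_comp _ _ _ (fun z : G * G => (z.2^-1 * z.1)%g) f);
    last exact: cf.
  apply: (@continuous_comp _ _ _ (fun z : G * G => (z.2^-1%g, z.1))
    (fun z : G * G => (z.1 * z.2)%g)); last exact: mulg_continuous.
  apply: cvg_pair; last exact: cvg_fst.
  apply: (@continuous_comp _ _ _ (fun z : G * G => z.2) (fun z => z^-1%g)).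
    exact: cvg_snd.
  exact: invg_continuous.
transitivity (\int[mu]_x \int[mu]_y (f x * g (y * x)%g)%:E).
  apply: eq_integral => x _; rewrite EFinM rintE// -ge0_integralZl//.
  - apply: (mEFin (f := fun y => g (y * x)%g)).
    by have [] := bump_mulgr x bg.
  - by move=> y _; rewrite lee_fin bump_ge0.
  - by rewrite lee_fin bump_ge0.
rewrite (haar_Fubini hausdorff_G exhaustion_G haar_mu
    (F := fun z => (f z.1 * g (z.2 * z.1)%g)%R)); last 2 first.
- move=> z; apply: continuousM.
    apply: (@continuous_comp _ _ _ (fun z : G * G => z.1) f); last exact: cf.
    exact: cvg_fst.
  apply: (@continuous_comp _ _ _ (fun z : G * G => (z.2 * z.1)%g) g);
    last exact: cg.
  apply: (@continuous_comp _ _ _ (fun z : G * G => (z.2, z.1))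
    (fun z : G * G => (z.1 * z.2)%g)); last exact: mulg_continuous.
  by apply: cvg_pair; [exact: cvg_snd|exact: cvg_fst].
- by move=> z; rewrite mulr_ge0// bump_ge0.
transitivity (\int[mu]_y \int[mu]_x (f (y^-1 * x)%g * g x)%:E).
  apply: eq_integral => y _ /=.
  rewrite -[RHS](haar_integral_mulgl haar_mu y).
  - by apply: eq_integral => x _ /=; rewrite mulKg.
  - apply: (mEFin (f := fun x => f (y^-1 * x)%g * g x)%R) => x.
    apply: continuousM; last exact: cg.
    apply: (@continuous_comp _ _ _ (fun x : G => (y^-1 * x)%g) f);
      last exact: cf.
    exact: continuous_mulgl.
  - by move=> x; rewrite lee_fin mulr_ge0// bump_ge0.
rewrite -(haar_Fubini hausdorff_G exhaustion_G haar_mu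
    (F := fun z => (f (z.2^-1 * z.1)%g * g z.1)%R)); last 2 first.
- move=> z; apply: continuousM; first exact: cdiv.
  apply: (@continuous_comp _ _ _ (fun z : G * G => z.1) g); last exact: cg.
  exact: cvg_fst.
- by move=> z; rewrite mulr_ge0// bump_ge0.
have cfV : continuous (fun y : G => f y^-1%g).
  move=> y; apply: (@continuous_comp _ _ _ (fun z : G => z^-1%g) f);
    last exact: cf.
  exact: invg_continuous.
transitivity (\int[mu]_x ((\int[mu]_y (f y^-1%g)%:E) * (g x)%:E)).
  apply: eq_integral => x _ /=.
  transitivity (\int[mu]_y ((g x)%:E * (f (y^-1 * x)%g)%:E)).
    by apply: eq_integral => y _; rewrite EFinM muleC.
  rewrite ge0_integralZl//.
  - rewrite muleC; congr (_ * _).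
    rewrite -[RHS](haar_integral_mulgl haar_mu x^-1%g).
    + by apply: eq_integral => y _ /=; rewrite invgM invgK.
    + exact: (mEFin (f := fun y => f y^-1%g)).
    + by move=> y; rewrite lee_fin bump_ge0.
  - apply: (mEFin (f := fun y => f (y^-1 * x)%g)) => y.
    apply: (@continuous_comp _ _ _ (fun y :
      G => (y^-1)%g) (fun y => f (y * x)%g)).
      exact: invg_continuous.
    by have [+ _ _] := bump_mulgr x bf; exact.
  - by move=> y _; rewrite lee_fin bump_ge0.
  - by rewrite lee_fin bump_ge0.
rewrite ge0_integralZl//.
- by rewrite rintE//; congr (_ * _); apply: eq_integral => x _; rewrite mulg1.
- exact: mEFin.
- by move=> x _; rewrite lee_fin bump_ge0.
- by apply: integral_ge0 => y _; rewrite lee_fin bump_ge0.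
Qed.

(** By [haar_twist], the integral of [f x * rint g x] depends on [g] only through the factor
    [rint g 1]. Hence the two sides have the same integral against every bump function [f]; being
    continuous in [x], they agree. *)
Lemma rint_ratio g g' x : bump g -> bump g' ->
  (rint g x * rint g' 1%g = rint g' x * rint g 1%g)%R.
Proof.
suff h k k' : bump k -> bump k' ->
    ~ (rint k x * rint k' 1%g < rint k' x * rint k 1%g)%R.
  by move=> bg bg'; apply/eqP; rewrite eq_le; apply/andP; split;
    rewrite leNgt; apply/negP; exact: h.
move=> bk bk' lt_kk'.
have ck := continuous_rint hausdorff_G locally_compact_G haar_mu bk.
have ck' := continuous_rint hausdorff_G locally_compact_G haar_mu bk'.
pose A y := (rint k y * rint k' 1%g)%R; pose B y := (rint k' y * rint k 1%g)%R.
have cA : continuous A by move=> y; apply: continuousM;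
  [exact: ck|exact: cvg_cst].
have cB : continuous B by move=> y; apply: continuousM;
  [exact: ck'|exact: cvg_cst].
have cBA : continuous (fun y => B y - A y)%R.
  by move=> y; apply: continuousB; [exact: cB|exact: cA].
(* Besides [A < B], a bound on [A] is imposed on [U]: it makes the integral of [f * A] finite,
   without which no strict inequality would follow. *)
pose U := (fun y => B y - A y)%R @^-1` `]0%R, +oo[ `&` A @^-1` `]-oo,
  (A x + 1)%R[.
have oU : open U.
  apply: openI; apply: open_comp; try exact: interval_open.
    by move=> y _; exact: cBA.
  by move=> y _; exact: cA.
have Ux : U x by split; rewrite /= in_itv/= ?andbT ?subr_gt0 ?ltrDl.
clear lt_kk'.
have xU : [set x] `<=` U by move=> y ->.
have [f [cf f01 f1 fU [M cM fM]]] := @urysohn_compact R _ _ _ hausdorff_G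
  locally_compact_G (@compact_set1 _ x) oU xU.
have bf : bump f by split => //; exists M.
have A0 y : (0 <= A y)%R by rewrite mulr_ge0// rint_ge0.
pose D y := (f y * (B y - A y))%R.
have D0 y : (0 <= D y)%R.
  have [Uy|nUy] := pselect (U y); last by rewrite /D fU ?mul0r.
  rewrite mulr_ge0 ?bump_ge0//; move: Uy => [+ _].
  by rewrite /= in_itv/= andbT => /ltW.
have cfA : continuous (fun y => f y * A y)%R.
  by move=> y; apply: (@continuousM _ _ f A y); [exact: cf|exact: cA].
have cD : continuous D by move=> y; apply: (@continuousM _ _ f (fun y =>
  B y - A y)%R y); [exact: cf|exact: cBA].
have fin : \int[mu]_y (f y * A y)%:E \is a fin_num.
  rewrite ge0_fin_numE; last first.
    by apply: integral_ge0 => y _; rewrite lee_fin mulr_ge0// bump_ge0.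
  apply: (@le_lt_trans _ _ (\int[mu]_y ((A x + 1)%:E * (f y)%:E))).
    apply: ge0_le_integral => //.
    - by move=> y _; rewrite lee_fin mulr_ge0// bump_ge0.
    - exact: mEFin.
    - by apply: emeasurable_funM => //; exact: mEFin.
    - move=> y _; rewrite -EFinM lee_fin.
      have [Uy|nUy] := pselect (U y); last by rewrite fU// mul0r mulr0.
      rewrite mulrC ler_wpM2r ?bump_ge0//; move: Uy => [_].
      by rewrite /= in_itv/= => /ltW.
  rewrite ge0_integralZl//.
  - by rewrite lte_mul_pinfty// ?lee_fin ?addr_ge0//; rewrite -ge0_fin_numE;
      [exact: bump_integral_fin|apply: integral_ge0 => y _;
        rewrite lee_fin bump_ge0].
  - exact: mEFin.
  - by move=> y _; rewrite lee_fin bump_ge0.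
  - by rewrite lee_fin addr_ge0.
(* The integral of [f * B] exceeds that of [f * A] by that of [D], which is positive because
   [D x > 0]; yet [haar_twist] makes the two equal. *)
suff : \int[mu]_y (f y * A y)%:E < \int[mu]_y (f y * A y)%:E by rewrite ltxx.
rewrite [ltRHS](_ : _ = \int[mu]_y (f y * B y)%:E).
  rewrite [ltRHS](_ : _ = \int[mu]_y (f y * A y)%:E + \int[mu]_y (D y)%:E).
    rewrite lteDl//; apply: (continuous_integral_gt0 hausdorff_G haar_mu (x :=
      x)) => //.
    rewrite /D f1// mul1r; move: Ux => [+ _].
    by rewrite /= in_itv/= andbT.
  rewrite -ge0_integralD//.
  - by apply: eq_integral => y _; rewrite -EFinD /D mulrBr addrC subrK.
  - by move=> y _; rewrite lee_fin mulr_ge0// bump_ge0.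
  - exact: mEFin.
  - by move=> y _; rewrite lee_fin.
  - exact: mEFin.
have intZ h c : bump h -> (0 <= c)%R ->
    \int[mu]_y (f y * (rint h y * c))%:E = c%:E * \int[mu]_y (f y * rint h
      y)%:E.
  move=> bh c0; rewrite -ge0_integralZl//.
  - by apply: eq_integral => y _; rewrite -EFinM mulrA mulrC.
  - apply: (mEFin (f := fun y => f y * rint h y)%R) => y; apply: continuousM;
      first exact: cf.
    exact: (continuous_rint hausdorff_G locally_compact_G haar_mu bh).
  - by move=> y _; rewrite lee_fin mulr_ge0// ?rint_ge0// bump_ge0.
rewrite (intZ _ _ bk (rint_ge0 mu 1%g bk')) (intZ _ _ bk' (rint_ge0 mu 1%g bk)).
rewrite (haar_twist bf bk) (haar_twist bf bk').
by rewrite muleCA [RHS]muleCA -!EFinM mulrC.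
Qed.

End ModularFunction.

(** * Measures of right-translated sets *)

Section RightTranslation.
Context (R : realType) (G : topologicalGroupType).
Hypotheses (hausdorff_G : hausdorff_space G).
Hypotheses (locally_compact_G : locally_compact [set: G]).
Hypotheses (exhaustion_G : compact_exhaustion G).
Context (mu : {measure set (borel G) -> \bar R}).
Hypothesis haar_mu : is_left_haar mu.
Implicit Types (K U : set G) (h x : G).
Local Open Scope ereal_scope.
Local Notation rint := (rint mu).
Local Notation rintE := (rintE hausdorff_G haar_mu).

Let trans h : borel G -> borel G := fun x => (x * h : G)%g.

Lemma measurable_right_mulg h : measurable_fun setT (trans h).
Proof. exact: (borel_continuous (@continuous_mulgr G h)). Qed.

Let mtrans h (A : set (borel G)) : measurable A -> measurable (trans h @^-1` A).
Proof. by move=> mA; rewrite -[X in measurable X]setTI;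
  exact: measurable_right_mulg. Qed.

(** The factor is read off from one bump function whose integrals are positive, and [rint_ratio]
    carries it over to all others. *)
Lemma rint_scale h : exists2 D : R, (0 < D)%R & forall g : G -> R, bump g ->
  rint g h = (D * rint g 1%g)%R.
Proof.
have [g [cg g01 g1 _ [M cM gM]]] := @urysohn_compact R _ _ _ hausdorff_G
  locally_compact_G (@compact_set1 _ (1%g : G)) openT (@subsetT _ _).
have bg : bump g by split => //; exists M.
have rint_gt0 x : (0 < rint g x)%R.
  rewrite -lte_fin rintE//.
  apply: (continuous_integral_gt0 hausdorff_G haar_mu (x := x^-1%g)
    (f := fun y => g (y * x)%g)).
  - by have [] := bump_mulgr x bg.
  - by move=> y; exact: bump_ge0.
  - by rewrite mulVg g1.
exists (rint g h / rint g 1%g)%R; first exact: divr_gt0.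
move=> f bf; apply: (@mulIf _ (rint g 1%g)); first by rewrite gt_eqF.
rewrite mulrAC divfK ?gt_eqF//.
exact: (rint_ratio hausdorff_G locally_compact_G exhaustion_G haar_mu).
Qed.

(** Bump functions squeezed between a compact and an open set transfer the scaling from integrals to
    measures. Inner regularity then settles open sets, and outer regularity all measurable sets. *)
Lemma haar_mulgr h : exists2 D : R, (0 < D)%R & forall A : set (borel G),
  measurable A -> pushforward mu (trans h) A = D%:E * mu A.
Proof.
have [D D0 rD] := rint_scale h; exists D => //.
have indic_bump (K U : set G) (f : G -> R) : continuous f ->
    (forall x, (0 <= f x <= 1)%R) -> (forall x, K x -> f x = 1%R) ->
    (forall x, ~ U x -> f x = 0%R) ->
    measurable (K : set (borel G)) -> measurable (U : set (borel G)) ->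
    mu K <= \int[mu]_x (f x)%:E <= mu U.
  move=> cf f01 f1 f0 mK mU.
  rewrite -(setIT K) -(setIT U) -!integral_indic//; apply/andP; split.
    apply: ge0_le_integral => //.
    - by apply/measurable_EFinP; exact: measurable_indic.
    - by apply/measurable_EFinP; exact: borel_continuous_real.
    - move=> x _; rewrite lee_fin indicE; have [Kx|nKx] := pselect (K x).
        by rewrite mem_set// f1.
      by rewrite memNset//; case/andP: (f01 x).
  apply: ge0_le_integral => //.
  - by move=> x _; rewrite lee_fin; case/andP: (f01 x).
  - by apply/measurable_EFinP; exact: borel_continuous_real.
  - by apply/measurable_EFinP; exact: measurable_indic.
  - move=> x _; rewrite lee_fin indicE; have [Ux|nUx] := pselect (U x).
      by rewrite mem_set//; case/andP: (f01 x).
    by rewrite memNset// f0.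
have compact_open K U : compact K -> open U -> K `<=` U ->
    mu (trans h @^-1` K) <= D%:E * mu U /\ D%:E * mu K <= mu (trans h @^-1` U).
  move=> cK oU KU.
  have [f [cf f01 f1 fU [M cM fM]]] := @urysohn_compact R _ _ _ hausdorff_G
    locally_compact_G cK oU KU.
  have bf : bump f by split => //; exists M.
  have mK : measurable (K : set (borel G)) by exact: borel_compact.
  have mU : measurable (U : set (borel G)) by exact: borel_open.
  have /andP[Kf fU'] := indic_bump K U f cf f01 f1 fU mK mU.
  have [cfh fh01 _] := bump_mulgr h bf.
  have /andP[Kfh fhU] := indic_bump (trans h @^-1` K) (trans h @^-1` U) _ cfh
    fh01
    (fun x => f1 (x * h)%g) (fun x => fU (x * h)%g) (@mtrans h _ mK) (@mtrans h
      _ mU).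
  have eqf : \int[mu]_x (f (x * h : G)%g)%:E = D%:E * \int[mu]_x (f x)%:E.
    rewrite -rintE// rD// EFinM rintE//; congr (_ * _).
    by apply: eq_integral => x _; rewrite mulg1.
  rewrite eqf {eqf} in Kfh fhU; split.
    by apply: (le_trans Kfh); rewrite lee_pmul2l.
  by apply: le_trans fhU; rewrite lee_pmul2l.
have openD U : open U -> mu (trans h @^-1` U) = D%:E * mu U.
  move=> oU; apply/eqP; rewrite eq_le; apply/andP; split.
    have oU' : open (trans h @^-1` U).
      by apply: open_comp => // x _; exact: continuous_mulgr.
    rewrite (haar_inner_regular haar_mu oU').
    apply: ge_ereal_sup => _ [K [cK KU] <-].
    have [|+ _] := compact_open _ U (@compact_mulgr _ h _ cK) oU.
      by move=> _ [x Kx <-]; exact: KU.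
    apply: le_trans; apply: le_measure; rewrite ?inE.
    - exact: borel_compact.
    - apply: mtrans; apply: borel_compact => //; exact: compact_mulgr.
    - by move=> x Kx; exists x.
  rewrite -lee_pdivlMl// (haar_inner_regular haar_mu oU).
  apply: ge_ereal_sup => _ [K [cK KU] <-].
  by rewrite lee_pdivlMl//; have [] := compact_open _ _ cK oU KU.
move=> A mA; rewrite /pushforward; apply/eqP; rewrite eq_le; apply/andP; split.
  rewrite -lee_pdivrMl// (haar_outer_regular haar_mu mA).
  apply: le_ereal_inf_tmp => _ [U [oU AU] <-].
  rewrite lee_pdivrMl// -openD//; apply: le_measure; rewrite ?inE.
  - exact: mtrans.
  - by apply: mtrans; exact: borel_open.
  - by move=> x /= Ax; exact: AU.
(* For the other inequality, an open [V] containing the preimage of [A] is itself the preimage of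
   the open set [V h], to which [openD] applies. *)
rewrite (haar_outer_regular haar_mu (@mtrans h _ mA)).
apply: le_ereal_inf_tmp => _ [V [oV AV] <-].
have oVh := @open_mulgr _ h _ oV.
have -> : mu V = mu (trans h @^-1` [set (x * h)%g | x in V]).
  congr (mu _); apply/seteqP; split => [x Vx|x /= [y Vy /mulIg <-//]].
  by exists x.
rewrite openD// lee_pmul2l//; apply: le_measure; rewrite ?inE//.
- exact: borel_open.
- move=> x Ax; exists (x * h^-1)%g; last by rewrite mulgVK.
  by apply: AV; rewrite /= /trans mulgVK.
Qed.

Lemma haar_integral_mulgr h : exists2 D : R, (0 < D)%R &
  forall F : borel G -> \bar R, measurable_fun setT F -> (forall x, 0 <= F x) ->
  \int[mu]_x F (x * h : G)%g = D%:E * \int[mu]_x F x.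
Proof.
have [D D0 HD] := haar_mulgr h; exists D => // F mF F0.
have := @ge0_integral_pushforward _ _ _ _ R _ (measurable_right_mulg h) mu
  setT F measurableT mF (fun x _ => F0 x).
rewrite preimage_setT => <-.
have := @ge0_integral_mscale _ _ R mu setT measurableT (NngNum (ltW D0)) F mF
  (fun x _ => F0 x).
move=> /= <-.
by apply: eq_measure_integral => [|? A mA _];
  [exact: measurable_right_mulg|exact: HD].
Qed.

End RightTranslation.

(** * L^p norms and strong continuity of left translations *)

Section LpGeneral.
Context d (T : measurableType d) (R : realType).
Variables (mu : {measure set T -> \bar R}) (p : R).
Hypothesis p1 : 1 <= p.
Implicit Types f g : T -> R.
Local Open Scope ereal_scope.
Local Notation "'N[ f ]" := (Lnorm mu p%:E (EFin \o f)).

Let p_gt0 : (0 < p)%R. Proof. exact: lt_le_trans p1. Qed.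
Let pV_gt0 : (0 < p^-1)%R. Proof. by rewrite invr_gt0. Qed.

(** The integral of a nonnegative function is a supremum over the simple functions below it, whence
    monotonicity. This generality is for [left_gradient], which may fail to be measurable. *)
Lemma ge0_le_integral_nonmeasurable (F H : T -> \bar R) :
  (forall x, 0 <= F x) -> (forall x, F x <= H x) ->
  \int[mu]_x F x <= \int[mu]_x H x.
Proof.
move=> F0 FH; have H0 x : 0 <= H x by exact: le_trans (FH x).
rewrite !ge0_integralTE//; apply: ge_ereal_sup => _ [h hF <-].
by apply: ereal_sup_ubound; exists h => // x; exact: le_trans (FH x).
Qed.

Lemma le_Lnorm (F H : T -> \bar R) : (forall x, `|F x| <= `|H x|) ->
  Lnorm mu p%:E F <= Lnorm mu p%:E H.
Proof.
move=> FH; rewrite unlock /Lnorm.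
apply: gt0_ler_poweR; rewrite ?in_itv/= ?leey ?andbT ?(ltW pV_gt0)//.
- by apply: integral_ge0 => x _; exact: poweR_ge0.
- by apply: integral_ge0 => x _; exact: poweR_ge0.
apply: ge0_le_integral_nonmeasurable => x; first exact: poweR_ge0.
by apply: gt0_ler_poweR; rewrite ?in_itv/= ?leey ?andbT ?abse_ge0 ?(ltW p_gt0).
Qed.

Lemma le_Lnorm_EFin f g : (forall x, `|f x| <= `|g x|)%R -> 'N[f] <= 'N[g].
Proof. by move=> fg; apply: le_Lnorm => x; rewrite lee_fin. Qed.

Lemma Lnorm_le_integral f (c : R) : (0 <= c)%R ->
  ('N[f] <= c%:E) = (\int[mu]_x (`|f x| `^ p)%:E <= (c `^ p)%:E).
Proof.
move=> c0; rewrite -[X in _ = (X <= _)](@powR_Lnorm _ _ _ mu (EFin \o f) p)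
  ?gt_eqF//.
rewrite -poweR_EFin; apply/idP/idP => h.
  by apply: gt0_ler_poweR; rewrite ?in_itv/= ?leey ?andbT ?lee_fin ?Lnorm_ge0
    ?(ltW p_gt0).
rewrite -[leLHS]poweRe1 ?Lnorm_ge0// -[leRHS]poweRe1 ?lee_fin//.
rewrite -(@mulfV _ p) ?gt_eqF// !poweRrM.
by apply: gt0_ler_poweR;
  rewrite ?in_itv/= ?leey ?andbT ?poweR_ge0 ?lee_fin ?powR_ge0 ?(ltW pV_gt0).
Qed.

Lemma measurable_powR_norm f : measurable_fun setT f ->
  measurable_fun setT (fun x => (`|f x| `^ p)%:E).
Proof.
move=> mf; apply/measurable_EFinP; apply: (measurableT_comp (measurable_powR
  p)).
exact: measurableT_comp.
Qed.

Lemma LnormZ_ge0 f (c : R) : (0 <= c)%R -> measurable_fun setT f ->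
  'N[(fun x => c * f x)%R] = c%:E * 'N[f].
Proof.
move=> c0 mf; rewrite unlock /Lnorm.
transitivity ((\int[mu]_x ((c `^ p)%:E * (`|f x| `^ p)%:E)) `^ p^-1).
  congr (_ `^ _); apply: eq_integral => x _ /=.
  by rewrite normrM ger0_norm// powRM// EFinM.
rewrite (ge0_integralZl mu measurableT (measurable_powR_norm mf)) ?lee_fin
  ?powR_ge0//.
rewrite poweRM ?lee_fin ?powR_ge0//; last first.
  by apply: integral_ge0 => x _; rewrite lee_fin powR_ge0.
by rewrite poweR_EFin -powRrM mulfV ?gt_eqF// powRr1.
Qed.

Lemma Lnorm_indic (A : set T) (c : R) : (0 <= c)%R -> measurable A ->
  ('N[\1_A] <= c%:E) = (mu A <= (c `^ p)%:E).
Proof.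
move=> c0 mA; rewrite Lnorm_le_integral//.
rewrite (_ : \int[mu]_x _ = \int[mu]_x (\1_A x)%:E).
  by rewrite integral_indic// setIT.
apply: eq_integral => x _; rewrite indicE; case: (x \in A) => /=.
  by rewrite normr1 powR1.
by rewrite normr0 powR0 ?gt_eqF.
Qed.

Lemma Lnorm_triangle f g : measurable_fun setT f -> measurable_fun setT g ->
  'N[(fun x => f x + g x)%R] <= 'N[f] + 'N[g].
Proof. by move=> mf mg; exact: minkowski_EFin. Qed.

(** Fatou's lemma for the p-th powers: at each point the sequence is eventually stationary, so its
    limit inferior is the value for [f]. *)
Lemma Lnorm_cvg_le f (F : nat -> T -> R) (c : R) : (0 <= c)%R ->
  (forall n, measurable_fun setT (F n)) ->
  (forall x, exists n, forall m, (n <= m)%N -> F m x = f x) ->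
  (forall n, 'N[F n] <= c%:E) -> 'N[f] <= c%:E.
Proof.
move=> c0 mF Ff Fc; rewrite Lnorm_le_integral//.
pose H n x := (`|F n x| `^ p)%:E.
have lim_einf_le (u : nat -> \bar R) l :
  (forall n, u n <= l) -> limn_einf u <= l.
  move=> ul; rewrite limn_einf_lim.
  apply: lime_le; first exact: is_cvg_einfs.
  by apply: nearW => n; apply: le_trans (ul n); apply: ereal_inf_lbound;
    exists n => /=.
have := @fatou _ _ _ mu setT measurableT H (fun n =>
  measurable_powR_norm (mF n)).
have H0 n x : [set: T] x -> 0 <= H n x by move=> _; rewrite lee_fin powR_ge0.
move=> /(_ H0); rewrite (_ : \int[mu]_x limn_einf (H ^~ x) =
    \int[mu]_x (`|f x| `^ p)%:E); last first.
  apply: eq_integral => x _; have [n Hn] := Ff x.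
  apply: (@cvg_limn_einf_sup _ _ _ _).1.
  apply: cvg_near_cst; exists n => // m /= nm.
  by rewrite /H Hn.
move=> /le_trans; apply; apply: lim_einf_le => n.
by rewrite -Lnorm_le_integral.
Qed.

Import HBNNSimple.

(** Dominated convergence along the standard simple approximations from below, with the p-th power
    of [f] as dominating function. *)
Lemma Lp_nnsfun_approx f (e : R) : (0 < e)%R -> measurable_fun setT f ->
  (forall x, 0 <= f x)%R -> 'N[f] < +oo ->
  exists2 s : {nnsfun T >-> R}, (forall x, s x <= f x)%R &
    'N[(fun x => f x - s x)%R] <= e%:E.
Proof.
move=> e0 mf f0 Nf.
have mEf : measurable_fun setT (EFin \o f) by exact/measurable_EFinP.
pose s n := nnsfun_approx measurableT mEf n.
have sf n x : (s n x <= f x)%R.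
  by rewrite -lee_fin /s nnsfun_approxE le_approx// => ? _; rewrite lee_fin.
have Nf' : mu.-integrable setT (fun x => (`|f x| `^ p)%:E).
  apply: Lfun_integrable => //; rewrite inE; apply/andP; split; rewrite inE //.
pose h n x := (`|f x - s n x| `^ p)%:E.
have mh n : measurable_fun setT (h n).
  by apply: measurable_powR_norm; apply: measurable_funB.
have h0 x : h ^~ x @ \oo --> 0.
  have /fine_cvgP[_ cvs] : EFin \o s ^~ x @ \oo --> (f x)%:E.
    by apply: (cvg_nnsfun_approx measurableT mEf) => // y _; rewrite lee_fin.
  apply: cvg_EFin; first exact: nearW.
  apply/cvgrPdist_le => k k0.
  (* Once the difference is at most [1], its p-th power is bounded by the difference itself, since
     [p >= 1]. *)
  have k1 : (0 < Num.min k 1)%R by rewrite lt_min k0 ltr01.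
  move/cvgrPdist_le : cvs => /(_ _ k1); apply: filterS => n /=.
  rewrite le_min => /andP[fsk fs1].
  rewrite sub0r normrN ger0_norm ?powR_ge0//; apply: le_trans fsk.
  rewrite -[leRHS]powRr1//.
  have [->|fs0] := eqVneq `|f x - s n x|%R 0%R; first by rewrite !powR0 ?gt_eqF.
  by apply: ger_powR => //; rewrite fs1 andbT lt0r fs0 normr_ge0.
have hf x n : `|h n x| <= (`|f x| `^ p)%:E.
  rewrite gee0_abs ?lee_fin ?powR_ge0//; apply: ge0_ler_powR;
    rewrite ?nnegrE ?(ltW p_gt0)//.
  rewrite !ger0_norm ?subr_ge0// lerBlDr lerDl.
  exact: fun_ge0.
have [_ _] := @dominated_convergence _ _ _ mu _ measurableT h (cst 0) _ mh
  (measurable_cst _) (aeW mu (fun x _ => h0 x)) Nf' (aeW mu (fun x n _ =>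
    hf x n)).
rewrite integral0 => /fine_cvgP[+ /cvgrPdist_le].
have ep : (0 < e `^ p)%R by rewrite powR_gt0.
move=> fin /(_ _ ep) small.
have [n [fn sn]] := filter_ex (filterI fin small).
exists (s n) => //; rewrite Lnorm_le_integral ?(ltW e0)//.
move: fn sn => /= fn; rewrite sub0r normrN => /(le_trans (ler_norm _)).
by rewrite -lee_fin fineK.
Qed.

End LpGeneral.

(** * Continuity of left translations in L^p *)

Section StrongContinuity.
Context (R : realType) (G : topologicalGroupType).
Hypotheses (hausdorff_G : hausdorff_space G).
Context (mu : {measure set (borel G) -> \bar R}).
Hypothesis haar_mu : is_left_haar mu.
Variable p : R.
Hypothesis p1 : 1 <= p.
Implicit Types (f : borel G -> R) (g x : G).
Local Open Scope ereal_scope.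
Local Notation "'N[ f ]" := (Lnorm mu p%:E (EFin \o f)).

Definition ldiff g f : borel G -> R := fun x => (left_translate g f x - f x)%R.

Lemma measurable_left_translate g f : measurable_fun setT f ->
  measurable_fun setT (left_translate g f).
Proof. by move=> mf; exact: (measurableT_comp mf (measurable_left_mulg g)). Qed.

Lemma measurable_ldiff g f : measurable_fun setT f ->
  measurable_fun setT (ldiff g f).
Proof. by move=> mf; apply: measurable_funB => //;
  exact: measurable_left_translate. Qed.

Lemma ldiffM g h f x :
  ldiff (g * h)%g f x = (left_translate g (ldiff h f) x + ldiff g f x)%R.
Proof. by rewrite /ldiff /left_translate invgM mulgA addrA subrK. Qed.

Lemma Lnorm_sub f f' : measurable_fun setT f -> measurable_fun setT f' ->
  'N[(fun x => f x - f' x)%R] <= 'N[f] + 'N[f'].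
Proof.
move=> mf mf'; apply: (le_trans (Lnorm_triangle mu p1 mf _)).
  exact: measurableT_comp.
by rewrite leeD2l//; apply: le_Lnorm_EFin => // x; rewrite normrN.
Qed.

(** Each letter of a word contributes one term by the cocycle identity [ldiffM], and left
    translations preserve the norm. *)
Lemma Lnorm_ldiff_le S (q : R) f : (0 <= q)%R -> measurable_fun setT f ->
  (forall s, S s -> 'N[ldiff s f] <= q%:E) ->
  forall n g, set_pow S n g -> 'N[ldiff g f] <= (n%:R * q)%:E.
Proof.
move=> q0 mf Sq; elim=> [|n IH] g.
  move=> /= ->; rewrite mul0r (_ : ldiff 1%g f = cst 0%R).
    by rewrite (_ : EFin \o cst 0%R = cst 0)// Lnorm0// gt_eqF// lte_fin
      (lt_le_trans _ p1).
  by apply/funext => x; rewrite /ldiff /left_translate invg1 mul1g subrr.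
move=> [s Ss [h Sh <-]].
rewrite (_ : ldiff _ f = fun x => (left_translate s (ldiff h f) x + ldiff s f
  x)%R); last first.
  by apply/funext => x; exact: ldiffM.
apply: (le_trans (Lnorm_triangle mu p1 _ _)).
- by apply: measurable_left_translate; exact: measurable_ldiff.
- exact: measurable_ldiff.
rewrite Lnorm_left_translate//; last exact: measurable_ldiff.
by rewrite mulrSr mulrDl mul1r EFinD; apply: leeD; [exact: IH|exact: Sq].
Qed.

Definition Lcontinuous f := measurable_fun setT f /\
  forall e : R, (0 < e)%R -> \forall g \near (1%g : G), 'N[ldiff g f] <= e%:E.

Lemma LcontinuousD f f' : Lcontinuous f -> Lcontinuous f' ->
  Lcontinuous (fun x => f x + f' x)%R.
Proof.
move=> [mf cf] [mf' cf']; split; first exact: measurable_funD.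
move=> e e0; have e2 : (0 < e / 2)%R by rewrite divr_gt0.
apply: filterS2 (cf _ e2) (cf' _ e2) => g fe f'e.
rewrite (_ : ldiff g _ = fun x => (ldiff g f x + ldiff g f' x)%R); last first.
  by apply/funext => x; rewrite /ldiff /left_translate opprD addrACA.
apply: (le_trans (Lnorm_triangle mu p1 _ _)); try exact: measurable_ldiff.
by rewrite [e]splitr EFinD; exact: leeD.
Qed.

Lemma LcontinuousN f : Lcontinuous f -> Lcontinuous (fun x => - f x)%R.
Proof.
move=> [mf cf]; split; first exact: measurableT_comp.
move=> e e0; apply: filterS (cf _ e0) => g; apply: le_trans.
by apply: le_Lnorm_EFin => // x; rewrite /ldiff /left_translate -opprD normrN.
Qed.

Lemma LcontinuousZ (c : R) f : (0 <= c)%R -> Lcontinuous f ->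
  Lcontinuous (fun x => c * f x)%R.
Proof.
move=> c0 [mf cf]; split; first by apply: measurable_funM.
move=> e e0; have c1 : (0 < c + 1)%R by rewrite ltr_wpDl.
have ec : (0 < e / (c + 1))%R by rewrite divr_gt0.
apply: filterS (cf _ ec) => g fe.
rewrite (_ : ldiff g _ = fun x => (c * ldiff g f x)%R); last first.
  by apply/funext => x; rewrite /ldiff /left_translate mulrBr.
rewrite LnormZ_ge0//; last exact: measurable_ldiff.
apply: (@le_trans _ _ (c%:E * (e / (c + 1))%:E)); first exact: lee_wpmul2l.
by rewrite -EFinM lee_fin mulrCA ler_piMr ?(ltW e0)// ler_pdivrMr// mul1r lerDl.
Qed.

Lemma Lcontinuous0 : Lcontinuous (fun=> 0%R).
Proof.
split; first exact: measurable_cst.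
move=> e e0; near=> g.
rewrite (_ : _ \o _ = cst 0); last by apply/funext => x;
  rewrite /= /ldiff /left_translate subrr.
by rewrite Lnorm0 ?lee_fin ?(ltW e0)// gt_eqF// lte_fin (lt_le_trans _ p1).
Unshelve. all: by end_near. Qed.

Lemma Lcontinuous_sum (I : Type) (r : seq I) (F : I -> borel G -> R) :
  (forall i, Lcontinuous (F i)) -> Lcontinuous (fun x => \sum_(i <- r) F i x)%R.
Proof.
move=> cF; elim: r => [|i r IH].
  by under eq_fun do rewrite big_nil; exact: Lcontinuous0.
by under eq_fun do rewrite big_cons; exact: LcontinuousD.
Qed.

Lemma Lcontinuous_lim f : measurable_fun setT f ->
  (forall e : R, (0 < e)%R ->
    exists2 f', Lcontinuous f' & 'N[(fun x => f x - f' x)%R] <= e%:E) ->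
  Lcontinuous f.
Proof.
move=> mf lim; split => // e e0; have e3 : (0 < e / 3)%R by rewrite divr_gt0.
have [f' [mf' cf'] ff'] := lim _ e3.
apply: filterS (cf' _ e3) => g f'e.
pose d (x : borel G) := (f x - f' x)%R.
have md : measurable_fun setT d by exact: measurable_funB.
rewrite (_ : ldiff g _ = fun x => (ldiff g f' x + ldiff g d x)%R); last first.
  apply/funext => x; rewrite /ldiff /left_translate /d; ring.
apply: (le_trans (Lnorm_triangle mu p1 _ _)); try exact: measurable_ldiff.
have -> : e = (e / 3 + (e / 3 + e / 3))%R by field.
rewrite EFinD; apply: leeD => //.
apply: (le_trans (Lnorm_sub _ _)) => //; first exact: measurable_left_translate.
by rewrite Lnorm_left_translate// EFinD; exact: leeD.
Qed.

(** [A] and a compact [K] both fill the open set [U] up to measure [d]. When [g] and its inverse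
    move [K] inside [U], the symmetric difference of [A] and [g A] lies in [E] and [g E], where [E]
    collects the two small defects. *)
Lemma Lcontinuous_indic (A : set (borel G)) : measurable A -> mu A < +oo ->
  Lcontinuous (\1_A).
Proof.
move=> mA Afin; split; first exact: measurable_indic.
(* [E] and its translate have two parts each, all of measure at most [d]: four in total. *)
move=> e e0; pose d := (e `^ p / 4)%R.
have d0 : (0 < d)%R by rewrite divr_gt0// powR_gt0.
have Afin' : mu A \is a fin_num by rewrite ge0_fin_numE.
have [U [oU AU] UA] : exists2 U : set G,
  open U /\ A `<=` U & mu U < mu A + d%:E.
  have := Afin'; rewrite (haar_outer_regular haar_mu mA) => infA.
  have [_ [U [oU AU] <-] Ud] := lb_ereal_inf_adherent d0 infA.
  by exists U.
have mU : measurable (U : set (borel G)) by exact: borel_open.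
have Ufin : mu U \is a fin_num.
  by rewrite ge0_fin_numE// (lt_trans UA)// -(fineK Afin') -EFinD ltry.
(* Inner regularity is assumed for open sets, so [K] approximates [U] and need not lie in [A]. *)
have [K [cK KU] UK] : exists2 K : set G,
  compact K /\ K `<=` U & mu U < mu K + d%:E.
  have := Ufin; rewrite (haar_inner_regular haar_mu oU) => supU.
  have [_ [K [cK KU] <-] Kd] := ub_ereal_sup_adherent d0 supU.
  by exists K => //; rewrite -lteBlDr.
have mK : measurable (K : set (borel G)) by exact: borel_compact.
have diff (B : set (borel G)) : measurable B -> B `<=` U ->
  mu U < mu B + d%:E ->
    mu (U `\` B) <= d%:E.
  move=> mB BU UB.
  have Bfin : mu B \is a fin_num.
    rewrite ge0_fin_numE//; apply: (@le_lt_trans _ _ (mu U));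
      last by rewrite -ge0_fin_numE.
    by apply: le_measure; rewrite ?inE.
  rewrite -(leeD2lE _ _ Bfin); apply: le_trans (ltW UB).
  rewrite -measureU//.
  - by rewrite setDUK.
  - exact: measurableD.
  - by rewrite setDE setICA setICr setI0.
pose E := (U `\` A) `|` (U `\` K).
have mE : measurable (E : set (borel G)) by apply: measurableU;
  exact: measurableD.
have E2 : mu E <= (d + d)%:E.
  apply: (le_trans (measureU2 _ _ _)); try exact: measurableD.
  by rewrite EFinD; apply: leeD; exact: diff.
have nearU (i : G -> G) : continuous i -> i 1%g = 1%g ->
    \forall g \near (1%g : G), K `<=` (fun x => U (i g * x)%g).
  move=> ci i1; move/compact_near_coveringP: cK; apply => x Kx.
  have cm : continuous (fun z : G * G => i z.2 * z.1)%g.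
    move=> z; apply: (@continuous_comp _ _ _ (fun z : G * G => (i z.2, z.1))
      (fun z : G * G => (z.1 * z.2)%g)); last exact: mulg_continuous.
    apply: cvg_pair; last exact: cvg_fst.
    apply: (@continuous_comp _ _ _ (fun z : G * G => z.2) i);
      first exact: cvg_snd.
    exact: ci.
  apply: (cm (x, 1%g : G)); apply: open_nbhs_nbhs; split => //=.
  by rewrite i1 mul1g; exact: KU.
have near1 : \forall g \near (1%g : G), K `<=` (fun x => U (g * x)%g).
  by apply: (nearU id) => // x; exact: cvg_id.
have near2 := nearU _ (@invg_continuous G) (@invg1 G).
apply: filterS2 near1 near2 => g gK gVK.
pose T := (fun x : borel G => (g^-1 * x : G)%g) @^-1` E.
have mT : measurable (T : set (borel G)).
  by rewrite -[X in measurable X]setTI; exact: measurable_left_mulg.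
apply: (@le_trans _ _ 'N[\1_(E `|` T)]).
  apply: le_Lnorm_EFin => // x; rewrite /ldiff /left_translate !indicE.
  have [ET|nET] := pselect ((E `|` T) x).
    rewrite (mem_set ET) normr1.
    by case: (_ \in A); case: (x \in A);
      rewrite ?subrr ?subr0 ?sub0r ?normrN ?normr1 ?normr0.
  (* If exactly one of [x] and [g^-1 * x] is in [A], then either that point is outside [K], or it is
     in [K] and the other one is in [U] but not in [A]. *)
  have -> : (((g^-1 * x)%g : borel G) \in A) = (x \in A);
    last by rewrite subrr normr0.
  apply/idP/idP => /set_mem Ax; apply/mem_set; apply: contrapT => nAx;
    apply: nET.
    have [Kx|nKx] := pselect (K (g^-1 * x)%g).
      by left; left; split => //; have := gK _ Kx; rewrite mulVKg.
    by right; right; split => //; exact: AU.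
  have [Kx|nKx] := pselect (K x).
    by right; left; split => //; exact: gVK.
  by left; right; split => //; exact: AU.
rewrite Lnorm_indic ?(ltW e0)//; last exact: measurableU.
apply: (le_trans (measureU2 _ _ _)) => //.
have -> : (e `^ p = (d + d) + (d + d))%R by rewrite /d; field.
rewrite [leRHS]EFinD; apply: leeD => //.
apply: le_trans E2; rewrite le_eqVlt; apply/orP; left; apply/eqP.
exact: (pushforward_left_mulg haar_mu g mE).
Qed.

Import HBNNSimple.

(** A simple function is a finite combination of indicators of its level sets; Chebyshev's
    inequality against [f] makes those of positive level finite in measure. *)
Lemma Lcontinuous_nnsfun (s : {nnsfun borel G >-> R}) f : 'N[f] < +oo ->
  (forall x, s x <= `|f x|)%R -> Lcontinuous s.
Proof.
move=> Nf sf.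
have sE : (s : borel G -> R) =
    fun x => (\sum_(v <- finmap.enum_fset (fset_set (range s))) (v * \1_(s
      @^-1` [set v]) x))%R.
  by apply/funext => x; rewrite fimfunE fsbig_finite.
rewrite sE; apply: Lcontinuous_sum => v.
have [v_le0|v_gt0] := leP v 0%R.
  rewrite (_ : (fun x => _) = fun=> 0%R); first exact: Lcontinuous0.
  apply/funext => x; rewrite indicE.
  have [sx|nsx] := pselect (s x = v); last by rewrite memNset// mulr0.
  by have /eqP -> : v == 0%R; rewrite ?mul0r// eq_le v_le0 -sx fun_ge0.
have v0 := ltW v_gt0.
have mB : measurable (s @^-1` [set v]) by rewrite -[X in measurable X]setTI;
  exact: measurable_funP.
apply: LcontinuousZ => //; apply: Lcontinuous_indic => //.
have vN : v%:E * 'N[\1_(s @^-1` [set v])] <= 'N[f].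
  rewrite -LnormZ_ge0//.
  apply: le_Lnorm_EFin => // x; rewrite indicE.
  have [sx|nsx] := pselect (s x = v); last by rewrite memNset// mulr0 normr0.
  by rewrite mem_set// mulr1 ger0_norm// -sx.
have NE : ('N[f] = (fine 'N[f])%:E) by rewrite fineK// ge0_fin_numE// Lnorm_ge0.
rewrite NE -lee_pdivlMl// -EFinM Lnorm_indic// in vN.
  by apply: le_lt_trans vN _; rewrite ltry.
by rewrite mulr_ge0 ?invr_ge0// fine_ge0// Lnorm_ge0.
Qed.

Lemma Lfun_Lcontinuous f : measurable_fun setT f -> 'N[f] < +oo ->
  Lcontinuous f.
Proof.
suff ge0 f' : measurable_fun setT f' -> (forall x, 0 <= f' x)%R ->
  'N[f'] < +oo ->
    Lcontinuous f'.
  move=> mf Nf.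
  have normE x : (`|f x| = f^\+ x + f^\- x)%R by rewrite -[RHS]/((f^\+ +
    f^\-)%R x) funrposDneg.
  have -> : f = (fun x => f^\+ x + - f^\- x)%R.
    by apply/funext => x; rewrite -[RHS]/((f^\+ - f^\-)%R x) funrposBneg.
  apply: LcontinuousD; [|apply: LcontinuousN]; apply: ge0.
  - exact: measurable_funrpos.
  - by move=> x; exact: funrpos_ge0.
  - apply: le_lt_trans Nf; apply: le_Lnorm_EFin => // x.
    by rewrite normE ger0_norm ?funrpos_ge0// lerDl funrneg_ge0.
  - exact: measurable_funrneg.
  - by move=> x; exact: funrneg_ge0.
  - apply: le_lt_trans Nf; apply: le_Lnorm_EFin => // x.
    by rewrite normE ger0_norm ?funrneg_ge0// lerDr funrpos_ge0.
move=> mf f0 Nf; apply: Lcontinuous_lim => // e e0.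
have [s sf fs] := Lp_nnsfun_approx p1 e0 mf f0 Nf.
exists s => //; apply: (Lcontinuous_nnsfun Nf) => x.
by rewrite ger0_norm.
Qed.

End StrongContinuity.

(** * Almost invariant functions at a given scale *)

Section Scale.
Context (R : realType) (G : topologicalGroupType).
Hypotheses (hausdorff_G : hausdorff_space G).
Hypotheses (locally_compact_G : locally_compact [set: G]).
Context (mu : {measure set (borel G) -> \bar R}).
Hypothesis haar_mu : is_left_haar mu.
Variable S : set G.
Hypotheses (compact_S : compact S) (symmetric_S : symmetric_set S).
Hypothesis generates_S : generates S.
Variable p : R.
Hypothesis p1 : 1 <= p.
Implicit Types (f : borel G -> R) (g x : G).
Local Open Scope ereal_scope.
Local Notation "'N[ f ]" := (Lnorm mu p%:E (EFin \o f)).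
Local Notation wlength := (wlength symmetric_S generates_S).

Let p_gt0 : (0 < p)%R. Proof. exact: lt_le_trans p1. Qed.
Let exhaustion_G := generated_compact_exhaustion compact_S symmetric_S
  generates_S.

(* Steinhaus: if [mu (S^n) > 0] then [S^n] meets its translates by small [g]. *)
Lemma set_pow_nbhs : exists n, \forall g \near (1%g : G), set_pow S n g.
Proof.
have mSn n : measurable (set_pow S n : set (borel G)).
  by apply: borel_compact => //; exact: compact_set_pow.
have [n Sn0] : exists n, mu (set_pow S n) != 0.
  apply: contrapT => /forallNP S0; have /eqP := haar_neq0 haar_mu; apply.
  have -> : [set: borel G] = \bigcup_n (set_pow S n : set (borel G)).
    apply/seteqP; split => // x _.
    by have [n] := set_pow_cover symmetric_S generates_S x; exists n.
  apply: (@measure_negligible _ _ _ mu); first exact: bigcupT_measurable.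
  apply: negligible_bigcup => n; exists (set_pow S n); split => //.
  by apply/eqP; apply: contrapT => /negP; exact: S0.
exists (n + n)%N; pose A := set_pow S n : set (borel G).
have Afin : mu A < +oo by apply: (haar_compact haar_mu); exact: compact_set_pow.
pose m := fine (mu A); have mA : mu A = m%:E by rewrite fineK// ge0_fin_numE.
have m0 : (0 < m)%R.
  by rewrite -lte_fin -mA lt0e Sn0 measure_ge0.
have {mA} mA : ~ (mu A <= (m / 2)%:E) by rewrite mA lee_fin; apply/negP;
  rewrite -ltNge; lra.
(* If [g] is not in [S^n S^n], then [A] and [g A] are disjoint and [ldiff] has norm at least that of
   the indicator of [A]; the choice [e ^ p = m / 2 < mu A] excludes this. *)
pose e := ((m / 2) `^ p^-1)%R.
have e0 : (0 < e)%R by rewrite powR_gt0// divr_gt0.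
have ep : (e `^ p = m / 2)%R.
  by rewrite /e -powRrM mulVf ?gt_eqF// powRr1// ltW// divr_gt0.
have [_ cA] := Lcontinuous_indic hausdorff_G haar_mu p1 (mSn n) Afin.
apply: filterS (cA _ e0) => g Ng.
apply: contrapT => nSg; apply: mA; rewrite -ep -(Lnorm_indic mu p1 (ltW e0)
  (mSn n)).
apply: le_trans Ng; apply: le_Lnorm_EFin => // x;
  rewrite /ldiff /left_translate !indicE.
have [Ax|nAx] := pselect (A x); last by rewrite memNset// normr0.
rewrite (mem_set Ax) memNset ?sub0r ?normrN// => Agx; apply: nSg.
have -> : g = (x * (g^-1 * x)^-1)%g by rewrite invgM invgK mulVKg.
by apply: set_powD => //; exact: set_powV.
Qed.

Lemma Lnorm_mulgr h : exists2 k : R, (0 < k)%R & forall f,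
  measurable_fun setT f ->
  'N[(fun x : borel G => f (x * h : G)%g)] = k%:E * 'N[f].
Proof.
have [D D0 HD] := haar_integral_mulgr hausdorff_G locally_compact_G
  exhaustion_G haar_mu h.
exists (D `^ p^-1)%R; first exact: powR_gt0.
move=> f mf; rewrite unlock /Lnorm.
have := HD _ (measurable_powR_norm p mf) (fun x => powR_ge0 _ _).
move=> /(congr1 (fun z => z `^ p^-1)); rewrite poweRM ?lee_fin ?(ltW D0)//.
by apply: integral_ge0 => x _; rewrite lee_fin powR_ge0.
Qed.

(** The ratio is stated as [d * J <= a] so as to include a vanishing gradient, for which the
    quotient is [+oo]. *)
Lemma isop_profile_gt (t : nat) (J : R) : (0 < J)%R ->
  J%:E < isop_profile mu S p t%:R ->
  exists f (a d : R), [/\ measurable_fun setT f, (0 < a)%R, 'N[f] = a%:E &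
    [/\ (d * J <= a)%R, forall s, S s -> 'N[ldiff s f] <= d%:E &
      forall x, f x != 0%R -> (wlength x <= t)%N]].
Proof.
move=> J0 /ereal_sup_gt[_ [f [fL Nf0 suppf] <-]] Jlt.
move: fL; rewrite inE => /andP[]; rewrite !inE/= => mf Nfy.
pose a := fine 'N[f]; have Na : 'N[f] = a%:E by rewrite fineK// ge0_fin_numE//
  Lnorm_ge0.
have a0 : (0 < a)%R by rewrite -lte_fin -Na lt0e Nf0 Lnorm_ge0.
pose D := Lnorm mu p%:E (left_gradient S f).
have D0 : 0 <= D by exact: Lnorm_ge0.
have ND s : S s -> 'N[ldiff s f] <= D.
  move=> Ss; apply: le_Lnorm => // x; apply: le_trans (lee_abs _).
  (* [ldiff s] evaluates at [s^-1 * x], hence the inverse and the symmetry of [S]. *)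
  by apply: ereal_sup_ubound; right; exists s^-1%g => //; exact: symmetric_S.
exists f, a, (fine D).
rewrite -/D Na in Jlt.
(* An infinite [D] would give the quotient [0], which is not above [J]. *)
have Dfin : D \is a fin_num /\ (fine D * J <= a)%R.
  move: D D0 Jlt {ND} => [d|_|//].
    rewrite lee_fin le_eqVlt => /predU1P[<-|d0]; first by rewrite mul0r ltW.
    rewrite inver gt_eqF// -EFinM lte_fin ltr_pdivlMr// mulrC => /ltW.
    by [].
  by rewrite invey mule0 lte_fin ltNge (ltW J0).
have [Df DJ] := Dfin; split => //; split => //.
- by move=> s Ss; rewrite fineK//; exact: ND.
- move=> x fx; have : word_ball S (t%:R : R) x.
    by apply: suppf; exact: subset_closure.
  by rewrite /word_ball /= (word_lengthE symmetric_S generates_S) lee_fin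
    ler_nat.
Qed.

(** A right translation commutes with [ldiff s] and multiplies all norms by the same [k], so the
    ratio of function to gradient survives; rescaling by [c] then fixes the norm. *)
Lemma isop_profile_scale (t : nat) (al be : R) (h : G) : (0 < t)%N ->
  ((t%:R `^ be)%R)%:E < isop_profile mu S p t%:R ->
  exists f, [/\ measurable_fun setT f, 'N[f] = (t%:R `^ al)%:E,
    forall s, S s -> 'N[ldiff s f] <= (t%:R `^ (al - be))%:E &
    forall x, f x != 0%R -> (wlength (x * h^-1)%g <= t)%N].
Proof.
move=> t0 Jt; have t0' : (0 < t%:R :> R)%R by rewrite ltr0n.
have [f [a [d [mf a0 Na [dJ Nd fs]]]]] := isop_profile_gt (powR_gt0 be t0') Jt.
have [k k0 Nk] := Lnorm_mulgr h^-1%g.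
pose c := (t%:R `^ al / (a * k))%R.
have c0 : (0 <= c)%R by rewrite divr_ge0 ?powR_ge0// mulr_ge0// ltW.
have ck : (c * k = t%:R `^ al / a)%R by rewrite /c; field; rewrite !gt_eqF.
have mfh f' : measurable_fun setT f' ->
    measurable_fun setT (fun x : borel G => f' (x * h^-1 : G)%g).
  by move=> mf'; exact: (measurableT_comp mf' (measurable_right_mulg h^-1%g)).
exists (fun x => c * f (x * h^-1 : G)%g)%R; split.
- by apply: measurable_funM => //; exact: mfh.
- rewrite LnormZ_ge0//; last exact: mfh.
  by rewrite Nk// Na -!EFinM mulrA ck divfK// gt_eqF.
- move=> s Ss; rewrite (_ : ldiff s _ = fun x => (c * ldiff s f (x * h^-1 :
    G)%g)%R); last first.
    by apply/funext => x; rewrite /ldiff /left_translate mulrBr mulgA.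
  rewrite LnormZ_ge0//; last by apply: mfh; exact: measurable_ldiff.
  rewrite Nk//; last exact: measurable_ldiff.
  rewrite muleA -EFinM ck; apply: (@le_trans _ _ ((t%:R `^ al / a)%:E * d%:E)).
    by apply: lee_wpmul2l; [rewrite lee_fin divr_ge0 ?powR_ge0// ltW|exact: Nd].
  rewrite -EFinM lee_fin powRB; last by rewrite (gt_eqF t0') implybT.
  rewrite -mulrA ler_wpM2l ?powR_ge0// ler_pdivrMl// ler_pdivlMr ?powR_gt0//.
- by move=> x fx; apply: fs; apply: contraNneq fx => ->; rewrite mulr0.
Qed.

End Scale.

(** * Superposition of the scales *)

(** Arithmetic of word lengths: [hk], [hj] are the lengths of the centres, [tk], [tj] the radii,
    [a], [y], [ay] the lengths of [a], [y], [a^-1 * y], and [yh] a distance to a centre. The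
    triangle inequality puts [hj] within [4 * tj] of [hk], against a gap of [10 * tj]. *)
Lemma scale_gap_above (hk hj tk tj y ay a yh : nat) :
  (a <= 4 * tk)%N -> (0 < tk)%N -> (2 * tk <= tj)%N -> (y <= yh + hk)%N ->
  (ay <= a + y)%N -> (yh <= tk)%N -> (hj <= tj + ay)%N ->
  (hk + 10 * tj <= hj)%N -> False.
Proof. lia. Qed.

Lemma scale_gap_below (hk hj tk tj y ay a yh : nat) :
  (a <= 4 * tk)%N -> (0 < tj)%N -> (2 * tj <= tk)%N -> (ay <= yh + hj)%N ->
  (y <= a + ay)%N -> (yh <= tj)%N -> (hk <= tk + y)%N ->
  (hj + 10 * tk <= hk)%N -> False.
Proof. lia. Qed.

Lemma scale_gap_origin (h0 hk tk x k : nat) : (k < tk)%N ->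
  (h0 + 10 * tk <= hk)%N -> (hk <= tk + x)%N -> (x < k)%N -> False.
Proof. lia. Qed.

Section ScaleSum.
Context (R : realType) (G : topologicalGroupType).
Hypotheses (hausdorff_G : hausdorff_space G).
Context (mu : {measure set (borel G) -> \bar R}).
Hypothesis haar_mu : is_left_haar mu.
Variable S : set G.
Hypotheses (compact_S : compact S) (symmetric_S : symmetric_set S).
Hypothesis generates_S : generates S.
Variable p : R.
Hypothesis p1 : 1 <= p.
Local Notation "'N[ f ]" := (Lnorm mu p%:E (EFin \o f)).
Local Notation wlength := (wlength symmetric_S generates_S).

Variables (w : nat -> borel G -> R) (h : nat -> G) (k0 : nat) (C z al : R).
Let T k := (2 ^ (k0 + k))%N.
Hypothesis measurable_w : forall k, measurable_fun setT (w k).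
Hypothesis Lnorm_w : forall k, ('N[w k] = ((T k)%:R `^ al)%:E)%E.
Hypotheses (C_ge0 : 0 <= C) (z_ge0 : 0 <= z) (z_lt1 : z < 1).
Hypothesis gradient_w : forall k s, S s ->
  ('N[ldiff s (w k)] <= (C * z ^+ k)%:E)%E.
Hypothesis support_w : forall k (x : G), w k x != 0 ->
  (wlength (x * (h k)^-1)%g <= T k)%N.
Hypothesis separated_h : forall j k, (j < k)%N ->
  (wlength (h j) + 10 * T k <= wlength (h k))%N.

Let T_gt0 k : (0 < T k)%N. Proof. by rewrite expn_gt0. Qed.

Let wlength_h k (x : G) : w k x != 0 -> (wlength (h k) <= T k + wlength x)%N.
Proof.
move=> /support_w wx; have -> : h k = ((x * (h k)^-1)^-1 * x)%g.
  by rewrite invgM invgK mulgVK.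
by apply: (leq_trans (wlengthM _ _ _ _)); rewrite wlengthV leq_add2r.
Qed.

(** For [k > 0], the points of the k-th support have length at least [9 * T k], which exceeds
    [k]. *)
Lemma scale_locally_finite k (x : G) : (wlength x < k)%N -> w k x = 0.
Proof.
move=> xk; apply: contrapT => /eqP /wlength_h hk.
have hk0 := @separated_h 0 k (leq_ltn_trans (leq0n _) xk).
apply: scale_gap_origin hk0 hk xk.
by apply: (leq_trans (ltn_expl k (ltnSn 1))); rewrite /T leq_exp2l// leq_addl.
Qed.

(** The upper bound on [g] is small against the gaps between different scales, so only [j = k] could
    interfere; the lower bound exceeds the diameter of the k-th ball and excludes that case. *)
Lemma scale_separated j k (g x : G) : (2 * T k < wlength g <= 4 * T k)%N ->
  w k x != 0 -> w j (g^-1 * x)%g = 0 /\ (j != k -> w j x = 0).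
Proof.
move=> /andP[gk gk4] wx.
have key (a y : G) : (wlength a <= 4 * T k)%N -> w j (a^-1 * y)%g != 0 ->
  w k y != 0 ->
    j = k.
  move=> ak wj wk; apply/eqP; rewrite eqn_leq; apply/andP; split;
    rewrite leqNgt; apply/negP => jk.
    have := separated_h jk; have := wlength_h wj; have := support_w wk.
    have := wlengthM symmetric_S generates_S a^-1%g y.
    have := wlengthM symmetric_S generates_S (y * (h k)^-1)%g (h k).
    rewrite mulgVK wlengthV.
    have : (2 * T k <= T j)%N by rewrite /T -expnS leq_exp2l// -addnS leq_add2l.
    have := T_gt0 k; exact: scale_gap_above ak.
  have := separated_h jk; have := wlength_h wk; have := support_w wj.
  have := wlengthM symmetric_S generates_S a (a^-1 * y)%g.
  have := wlengthM symmetric_S generates_S (a^-1 * y * (h j)^-1)%g (h j).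
  rewrite mulVKg mulgVK.
  have : (2 * T j <= T k)%N by rewrite /T -expnS leq_exp2l// -addnS leq_add2l.
  have := T_gt0 j; exact: scale_gap_below ak.
split; last first.
  move=> jk; apply: contrapT => /eqP wj; move/eqP: jk; apply;
    apply: (key 1%g x) => //.
    by rewrite wlength1.
  by rewrite invg1 mul1g.
apply: contrapT => /eqP wj; have jk := key g x gk4 wj wx.
rewrite {}jk in wj.
(* Both [x] and [g^-1 * x] would lie in [B(1, T k) h_k], making [g] a product of an element of
   [B(1, T k)] and the inverse of another. *)
have := support_w wj; have := support_w wx.
have := wlengthM symmetric_S generates_S (x * (h k)^-1)%g (g^-1 * x * (h
  k)^-1)^-1%g.
have -> : ((x * (h k)^-1) * (g^-1 * x * (h k)^-1)^-1)%g = g.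
  by rewrite -[(g^-1 * x * _)%g]mulgA invgM invgK mulVKg.
rewrite wlengthV => h1 h2 h3; move: gk; rewrite ltnNge => /negP; apply.
by apply: (leq_trans h1); rewrite mulSn mul1n leq_add.
Qed.

(* The sum of all the [w k]: the terms with [k > wlength x] vanish at [x]. *)
Definition scale_sum (x : borel G) : R := \sum_(0 <= k < (wlength x).+1) w k x.

Let partial n m (x : borel G) : R := \sum_(n <= k < n + m) w k x.

Lemma scale_sumE n m (x : borel G) : (wlength x < n + m)%N ->
  partial n m x = scale_sum x - \sum_(0 <= k < n) w k x.
Proof.
move=> xn; have -> : scale_sum x = \sum_(0 <= k < n + m) w k x.
  rewrite [RHS](big_cat_nat (leq0n (wlength x).+1) xn)/= [X in _ = _ +
    X]big_nat_cond.
  rewrite [X in _ = _ + X]big1 ?addr0// => k; rewrite andbT => /andP[xk _].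
  exact: scale_locally_finite.
by rewrite (big_cat_nat (leq0n n) (leq_addr m n))/= addrAC subrr add0r.
Qed.

Let measurable_partial n m : measurable_fun setT (partial n m).
Proof. by apply: measurable_sum => k; exact: measurable_w. Qed.

Let scale_sum0E n (x : borel G) : (wlength x < n)%N ->
  partial 0 n x = scale_sum x.
Proof. by move=> xn; rewrite scale_sumE// big_geq// subr0. Qed.

Lemma measurable_scale_sum : measurable_fun setT scale_sum.
Proof.
apply: (@measurable_fun_cvg _ _ _ _ (fun n => partial 0 n)) => // x _.
apply: cvg_near_cst; exists (wlength x).+1 => // n /= xn; exact: scale_sum0E.
Qed.

Local Open Scope ereal_scope.

(** The sum of the geometric series of the gradient bounds from the index [n] on. *)
Let tail n : R := (C * z ^+ n / (1 - z))%R.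

Lemma gradient_partial n m s : S s -> 'N[ldiff s (partial n m)] <= (tail n)%:E.
Proof.
move=> Ss.
have z1 : (0 < 1 - z)%R by rewrite subr_gt0.
(* The exact finite geometric sum, unlike its upper bound [tail n], can be propagated by induction
   on [m]. *)
apply: (@le_trans _ _ (C * z ^+ n * (1 - z ^+ m) / (1 - z))%:E); last first.
  rewrite lee_fin /tail ler_pM2r ?invr_gt0// ler_piMr ?mulr_ge0 ?exprn_ge0//.
  by rewrite gerBl exprn_ge0.
elim: m => [|m IH].
  rewrite expr0 subrr mulr0 mul0r (_ : _ \o _ = cst 0).
    by rewrite Lnorm0// gt_eqF// lte_fin (lt_le_trans _ p1).
  by apply/funext => x; rewrite /= /ldiff /left_translate /partial addn0
    !big_geq// subrr.
rewrite (_ : ldiff s _ = fun x => (ldiff s (partial n m) x + ldiff s (w (n +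
  m)%N) x)%R).
  apply: (le_trans (Lnorm_triangle mu p1 _ _)); try exact: measurable_ldiff.
  have -> : (C * z ^+ n * (1 - z ^+ m.+1) / (1 - z) =
      C * z ^+ n * (1 - z ^+ m) / (1 - z) + C * z ^+ (n + m))%R.
    by rewrite exprD exprS; field; rewrite gt_eqF.
  by rewrite EFinD; apply: leeD => //; exact: gradient_w.
apply/funext => x; rewrite /ldiff /left_translate /partial addnS.
by rewrite !big_nat_recr/= ?leq_addr// opprD addrACA.
Qed.

(** Blocks of terms obey the bound uniformly in their length, and Fatou's lemma in the form
    [Lnorm_cvg_le] passes it to the infinite tail. *)
Lemma gradient_scale_tail n N g : set_pow S N g ->
  'N[ldiff g (fun x => scale_sum x - \sum_(0 <= k < n) w k x)%R] <= (N%:R *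
    tail n)%:E.
Proof.
move=> SNg.
have tail0 : (0 <= tail n)%R by rewrite divr_ge0 ?mulr_ge0 ?exprn_ge0//
  subr_ge0 ltW.
apply: (@Lnorm_cvg_le _ _ _ mu p p1 _ (fun m => ldiff g (partial n m))).
- by rewrite mulr_ge0.
- by move=> m; exact: measurable_ldiff.
(* [ldiff g] sees the points [x] and [g^-1 * x]; past both lengths the block sums are stationary. *)
- move=> x; exists (wlength x + wlength (g^-1 * x)%g).+1 => m xm.
  rewrite /ldiff /left_translate !scale_sumE//.
    by rewrite (leq_trans _ (leq_addl _ _))// (leq_trans _ xm)// ltnS leq_addr.
  by rewrite (leq_trans _ (leq_addl _ _))// (leq_trans _ xm)// ltnS leq_addl.
- move=> m; apply: (Lnorm_ldiff_le haar_mu p1 tail0 _ _ SNg); first by [].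
  by move=> s; exact: gradient_partial.
Qed.

Lemma gradient_scale_sum N g : set_pow S N g ->
  'N[ldiff g scale_sum] <= (N%:R * tail 0)%:E.
Proof.
move=> SNg; have := gradient_scale_tail 0 SNg.
rewrite (_ : (fun x => _) = scale_sum)//.
by apply/funext => x; rewrite big_geq// subr0.
Qed.

(** A finite part of the sum is in L^p and so translates continuously; the tail is uniformly small
    on [S^N], a neighbourhood of [1] for a suitable [N]. *)
Lemma Lcontinuous_scale_sum (e : R) : (0 < e)%R ->
  \forall g \near (1%g : G), 'N[ldiff g scale_sum] <= e%:E.
Proof.
move=> e0; have e2 : (0 < e / 2)%R by rewrite divr_gt0.
have [N nN] := set_pow_nbhs hausdorff_G haar_mu compact_S symmetric_S
  generates_S p1.
have [n Nn] : exists n, (N%:R * tail n <= e / 2)%R.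
  have cz : ((fun n => N%:R * tail n) @ \oo --> (0 : R))%R.
    rewrite /tail (_ : (fun n => _) = (fun n =>
      (N%:R * C / (1 - z)) * z ^+ n)%R); last first.
      by apply/funext => n; rewrite !mulrA -!mulrA [(_ / _)%R]mulrC !mulrA.
    rewrite -[X in _ --> X](mulr0 (N%:R * C / (1 - z))%R).
    apply: cvgM; first exact: cvg_cst.
    by apply: cvg_expr; rewrite ger0_norm.
  move/cvgrPdist_le : cz => /(_ _ e2) cz; have [n] := filter_ex cz.
  by rewrite sub0r normrN => /(le_trans (ler_norm _)) ?; exists n.
pose F x := (\sum_(0 <= k < n) w k x)%R : R.
have cF : Lcontinuous mu p F.
  apply: Lcontinuous_sum => // k; apply: Lfun_Lcontinuous => //.
  by rewrite Lnorm_w ltry.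
have [mF {}cF] := cF.
apply: filterS2 nN (cF _ e2) => g SNg NF.
rewrite (_ : ldiff g _ =
  fun x => (ldiff g F x + ldiff g (fun x => scale_sum x - F x) x)%R);
    last first.
  by apply/funext => x; rewrite /ldiff /left_translate /F; ring.
apply: (le_trans (Lnorm_triangle mu p1 _ _)).
- exact: measurable_ldiff.
- by apply: measurable_ldiff; apply: measurable_funB => //;
    exact: measurable_scale_sum.
rewrite [e]splitr EFinD; apply: leeD => //.
by apply: (le_trans (gradient_scale_tail n SNg)); rewrite lee_fin.
Qed.

(** By [scale_separated], [ldiff g scale_sum] equals [- w k] on the support of [w k]. *)
Lemma Lnorm_ldiff_scale_sum_ge k g : (2 * T k < wlength g <= 4 * T k)%N ->
  ((T k)%:R `^ al)%:E <= 'N[ldiff g scale_sum].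
Proof.
move=> gk; rewrite -Lnorm_w; apply: le_Lnorm_EFin => // x.
have [->|wx] := eqVneq (w k x) 0%R; first by rewrite normr0.
rewrite /ldiff /left_translate.
have -> : scale_sum (g^-1 * x)%g = 0%R.
  by rewrite /scale_sum big1// => j _; have [] := scale_separated j gk wx.
rewrite sub0r normrN.
pose n := (wlength x + k).+1.
rewrite -(@scale_sum0E n) ?ltnS ?leq_addr// /partial add0n (bigD1_seq k)/=;
  last 2 first.
- by rewrite mem_index_iota /n ltnS leq_addl.
- exact: (iota_uniq 0 n).
rewrite big1_seq ?addr0// => j /andP[jk _].
by have [_ ->] := scale_separated j gk wx.
Qed.

End ScaleSum.

(** * The cocycle and its compression *)

Section Coboundary.
Context (R : realType) (G : topologicalGroupType).
Context (mu : {measure set (borel G) -> \bar R}).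
Hypothesis haar_mu : is_left_haar mu.
Variables (p : R) (p1 : (1 <= p%:E)%E).
Implicit Types g x : G.
Local Open Scope ereal_scope.
Local Notation "'N[ f ]" := (Lnorm mu p%:E (EFin \o f)).

Lemma ae_left_translate g (P : borel G -> Prop) : {ae mu, forall x, P x} ->
  {ae mu, forall x : borel G, P (g^-1 * x : G)%g}.
Proof.
move=> [N [mN N0 PN]].
exists ((fun x : borel G => (g^-1 * x : G)%g) @^-1` N); split.
- by rewrite -[X in measurable X]setTI; exact: measurable_left_mulg.
- by have := pushforward_left_mulg haar_mu g mN; rewrite /pushforward => ->.
- by move=> x nP; apply: PN.
Qed.

Variable f : borel G -> R.
Hypothesis measurable_f : measurable_fun setT f.
Hypothesis Lnorm_f : forall g, 'N[ldiff g f] < +oo.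

Lemma ldiff_Lfun g : ldiff g f \in Lfun mu p%:E.
Proof.
rewrite inE; apply/andP; split; rewrite inE/=; first exact: measurable_ldiff.
exact: Lnorm_f.
Qed.

(* Only formally a coboundary: [f] need not be in L^p. *)
Definition coboundary g : LspaceType mu p1 :=
  Lspace_of (Lfun_Sub p1 (ldiff_Lfun g)).

Lemma coboundaryE g : {ae mu, forall x, coboundary g x = ldiff g f x}.
Proof. exact: Lspace_ofE. Qed.

Lemma norm_coboundary g : `|coboundary g|%:E = 'N[ldiff g f].
Proof. by rewrite Lspace_normE Lnorm_Lspace_of. Qed.

Let ae_and (P Q : borel G -> Prop) : {ae mu, forall x, P x} ->
  {ae mu, forall x, Q x} -> {ae mu, forall x, P x /\ Q x}.
Proof. exact: filterI. Qed.

Let ae_imply (P Q : borel G -> Prop) : (forall x, P x -> Q x) ->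
  {ae mu, forall x, P x} -> {ae mu, forall x, Q x}.
Proof. by move=> PQ hP; apply: filterS hP. Qed.

Lemma coboundaryM g h :
  coboundary (g * h)%g = (left_regular haar_mu g (coboundary h) + coboundary
    g)%R.
Proof.
apply: Lspace_aeP.
have e1 := coboundaryE (g * h)%g.
have e2 := Lspace_addE (left_regular haar_mu g (coboundary h)) (coboundary g).
have e3 := left_regularE haar_mu g (coboundary h).
have e4 := ae_left_translate g (coboundaryE h).
have e5 := coboundaryE g.
apply: ae_imply (ae_and (ae_and e1 e2) (ae_and e3 (ae_and e4 e5))).
move=> x [[a1 a2] [a3 [a4 a5]]].
by rewrite a1 [RHS]a2 a3 a4 a5 ldiffM.
Qed.

Lemma norm_left_regular g (F : LspaceType mu p1) :
  `|left_regular haar_mu g F|%R = `|F|%R.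
Proof.
apply: EFin_inj; rewrite !Lspace_normE Lnorm_Lspace_of.
exact: (Lnorm_left_translate haar_mu p g (Lspace_measurable F)).
Qed.

Hypothesis Lcontinuous_f : forall e : R, (0 < e)%R ->
  \forall g \near (1%g : G), 'N[ldiff g f] <= e%:E.

(** The cocycle identity and the isometry of translations reduce continuity at [g0] to continuity at
    [1]. *)
Lemma coboundary_cocycle : cocycle (left_regular haar_mu (p1 := p1)) coboundary.
Proof.
split; last by move=> g h; exact: coboundaryM.
move=> g0; apply/cvgrPdist_le => e e0.
have : \forall g \near g0, 'N[ldiff (g0^-1 * g)%g f] <= e%:E.
  apply: (@continuous_mulgl G g0^-1%g g0 [set g | 'N[ldiff g f] <= e%:E]).
  by rewrite mulVg; exact: Lcontinuous_f.
apply: filterS => g; rewrite -norm_coboundary lee_fin.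
rewrite -(norm_left_regular g0) => le_e.
have -> : coboundary g =
    (left_regular haar_mu g0 (coboundary (g0^-1 * g)%g) + coboundary g0)%R.
  by rewrite -coboundaryM mulVKg.
by rewrite opprD addrCA subrr addr0 normrN.
Qed.

End Coboundary.

Lemma isop_exponent_gt (R : realType) (G : topologicalGroupType)
    (mu : {measure set (borel G) -> \bar R}) (S : set G) (p be : R) : 0 < be ->
  (be%:E < isop_exponent mu S p)%E ->
  \forall t \near +oo, ((t `^ be)%:E < isop_profile mu S p t)%E.
Proof.
move=> be0; rewrite /isop_exponent limf_einfE =>
  /ereal_sup_gt[_ [V V_oo <-]] be_lt.
near=> t.
have Vt : V t by near: t.
(* For [t > 1] the denominator [ln t] is positive and can be cleared. *)
have t1 : 1 < t by near: t; apply: nbhs_pinfty_gt; rewrite num_real.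
have t0 : 0 < t by exact: lt_trans t1.
have lnt : 0 < ln t by exact: ln_gt0.
have : (be%:E < lne (isop_profile mu S p t) / (ln t)%:E)%E.
  by apply: lt_le_trans be_lt _; apply: ereal_inf_lbound; exists t.
rewrite inver gt_eqF// lte_pdivlMr// -EFinM.
case: (isop_profile mu S p t) => [r| |];
  last by rewrite le0_lneNy ?leNye// ltNge leNye.
  have [r0|r0] := leP r 0; first by rewrite le0_lneNy ?lee_fin// ltNge leNye.
  rewrite lne_EFin// !lte_fin => lt_r.
  by rewrite /powR gt_eqF// -ltr_ln ?posrE ?expR_gt0// expRK.
by move=> _; exact: ltry.
Unshelve. all: by end_near. Qed.

(** * Cocycles with large compression *)

Section CompressionExponent.
Context (R : realType) (G : topologicalGroupType).
Hypotheses (hausdorff_G : hausdorff_space G).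
Hypotheses (locally_compact_G : locally_compact [set: G]).
Context (mu : {measure set (borel G) -> \bar R}).
Hypothesis haar_mu : is_left_haar mu.
Variable S : set G.
Hypotheses (compact_S : compact S) (symmetric_S : symmetric_set S).
Hypothesis generates_S : generates S.
Variables (p : R) (p1 : (1 <= p%:E)%E).
Local Notation "'N[ f ]" := (Lnorm mu p%:E (EFin \o f)).
Local Notation wlength := (wlength symmetric_S generates_S).

Let p1' : 1 <= p. Proof. by rewrite -lee_fin. Qed.

(** Beyond [N] the compression is an infimum over the empty set, that is [+oo], so even the zero
    cocycle dominates every power. *)
Lemma compression_bounded_wlength (N : nat) (al : R) :
  (forall g : G, (wlength g <= N)%N) ->
  exists2 b : G -> LspaceType mu p1, cocycle (left_regular haar_mu (p1 :=
    p1)) b &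
    dominates_power (compression S b) al.
Proof.
move=> ell_le.
pose f0 : borel G -> R := fun=> 0.
have mf0 : measurable_fun setT f0 by exact: measurable_cst.
have L0 g : 'N[ldiff g f0] = 0%E.
  rewrite (_ : _ \o _ = cst 0%E) ?Lnorm0// ?gt_eqF ?lte_fin ?(lt_le_trans
    ltr01)//.
  by apply/funext => x; rewrite /= /ldiff /left_translate subrr.
have Lfin g : ('N[ldiff g f0] < +oo)%E by rewrite L0.
exists (coboundary p1 mf0 Lfin).
  by apply: coboundary_cocycle => e e0; near=> g; rewrite L0 lee_fin ltW.
exists 1 => //; exists 1 => //; near=> t; rewrite mul1e mul1r /compression.
rewrite [X in ereal_inf X](_ : _ = set0) ?ereal_inf0 ?leey//.
apply/seteqP; split => // x [g /= + _].
rewrite (word_lengthE symmetric_S generates_S) lee_fin => tg.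
have tN : N%:R < t by near: t; apply: nbhs_pinfty_gt; exact: num_real.
by move: (lt_le_trans tN tg); rewrite ltr_nat ltnNge ell_le.
Unshelve. all: by end_near. Qed.

Lemma compression_unbounded_wlength (al be : R) : 0 <= al -> al < be ->
  (be%:E < isop_exponent mu S p)%E ->
  (forall N, exists g : G, (N < wlength g)%N) ->
  exists2 b : G -> LspaceType mu p1, cocycle (left_regular haar_mu (p1 :=
    p1)) b &
    dominates_power (compression S b) al.
Proof.
move=> al0 albe be_lt unbounded.
have be0 : 0 < be by exact: le_lt_trans albe.
have [k0 Jk0] : exists k0, forall k, (k0 <= k)%N ->
    ((((2 ^ k)%N%:R `^ be) : R)%:E < isop_profile mu S p (2 ^ k)%N%:R)%E.
  have [M [_ HM]] := isop_exponent_gt be0 be_lt.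
  exists (Num.trunc `|M|).+1 => k kM; apply: HM.
  apply: (le_lt_trans (ler_norm _)); apply: (lt_le_trans (truncnS_gt _)).
  rewrite ler_nat; apply: (leq_trans kM); apply: ltnW; exact: ltn_expl.
pose T k := (2 ^ (k0 + k))%N.
have /choice[H HH] := unbounded.
(* The centres are chosen recursively, each beyond the last by more than ten times its own
   radius. *)
pose fix h k : G := if k is k'.+1 then H (wlength (h k') + 10 * T k)%N else 1%g.
have hS k : (wlength (h k) + 10 * T k.+1 <= wlength (h k.+1))%N by rewrite
  ltnW//= HH.
have separated_h j k : (j < k)%N -> (wlength (h j) + 10 * T k <= wlength (h
  k))%N.
  elim: k => // k IH; rewrite ltnS leq_eqVlt => /predU1P[->//|/IH jk].
  apply: leq_trans (hS k); rewrite leq_add2r; apply: leq_trans jk;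
    exact: leq_addr.
have /choice[w Hw] : forall k, exists f :
  borel G -> R, [/\ measurable_fun setT f,
    'N[f] = ((T k)%:R `^ al)%:E,
    forall s, S s -> ('N[ldiff s f] <= ((T k)%:R `^ (al - be))%:E)%E &
    forall x, f x != 0 -> (wlength (x * (h k)^-1)%g <= T k)%N].
  move=> k; apply: isop_profile_scale => //; first by rewrite expn_gt0.
  by apply: Jk0; exact: leq_addr.
(* Along the dyadic scales the gradient bounds form a geometric sequence, with ratio below [1]
   because [al < be]. *)
pose C : R := (2 ^ k0)%N%:R `^ (al - be); pose z : R := 2 `^ (al - be).
have C0 : 0 <= C by exact: powR_ge0.
have z0 : 0 <= z by exact: powR_ge0.
have z1 : z < 1.
  by rewrite /z /powR pnatr_eq0/= expR_lt1 nmulr_rlt0 ?subr_lt0// ln_gt0//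
    ltr1n.
have TE k : (T k)%:R `^ (al - be) = C * z ^+ k :> R.
  rewrite /T expnD natrM powRM// -/C; congr (_ * _).
  by rewrite natrX -powR_mulrn// powRAC powR_mulrn.
have mw k : measurable_fun setT (w k) by have [] := Hw k.
have Nw k : 'N[w k] = ((T k)%:R `^ al)%:E by have [] := Hw k.
have gw k s : S s -> ('N[ldiff s (w k)] <= (C * z ^+ k)%:E)%E.
  by move=> Ss; rewrite -TE; have [_ _ + _] := Hw k; exact.
have sw k (x : G) : w k x != 0 -> (wlength (x * (h k)^-1)%g <= T k)%N.
  by have [_ _ _] := Hw k; exact.
pose f := scale_sum symmetric_S generates_S w.
have mf : measurable_fun setT f.
  exact: (measurable_scale_sum mw sw separated_h).
have Lf g : ('N[ldiff g f] < +oo)%E.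
  apply: le_lt_trans (ltry _).
  apply: (gradient_scale_sum haar_mu p1' mw C0 z0 z1 gw sw separated_h).
  exact: (wlengthP symmetric_S generates_S).
exists (coboundary p1 mf Lf).
  apply: coboundary_cocycle => e e0.
  exact: (Lcontinuous_scale_sum hausdorff_G haar_mu compact_S p1' mw Nw C0 z0
    z1 gw sw separated_h).
(* The factor [4 ^ al] pays for [t <= |g| <= 4 * T k], while the norm is only bounded below by
   [(T k) ^ al]. *)
exists 1 => //; exists (4 `^ al); first exact: powR_gt0.
near=> t; rewrite mul1r -lee_pdivrMl ?powR_gt0//.
apply: le_ereal_inf_tmp => _ [g /= tg <-].
rewrite norm_coboundary lee_pdivrMl ?powR_gt0//.
move: tg; rewrite (word_lengthE symmetric_S generates_S) lee_fin => tg.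
have kg : (2 ^ k0.+1 < wlength g)%N.
  rewrite -(ltr_nat R); apply: lt_le_trans tg; near: t.
  by apply: nbhs_pinfty_gt; rewrite num_real.
have g1 : (1 < wlength g)%N by apply: leq_ltn_trans kg; rewrite expn_gt0.
(* Here [|g|] lies above [2 ^ (m - 1)] and is at most [2 ^ m], so the scale of radius [2 ^ (m - 2)]
   is the one to use; [kg] ensures that it is among the [T k]. *)
have := up_log_bounds (ltnSn 1) g1; set m := up_log 2 _ => /= /andP[mg gm].
have mk : (k0.+2 <= m)%N.
  by rewrite -(ltn_exp2l k0.+1 m (ltnSn 1)); exact: leq_trans kg gm.
pose k := (m - k0.+2)%N.
have mE : m = (k0 + k).+2 by rewrite -[LHS](subnKC mk) !addSn.
have Tg : (2 * T k < wlength g <= 4 * T k)%N.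
  by rewrite /T -expnS -[4%N]/(2 ^ 2)%N -expnD; rewrite mE in mg gm;
    rewrite mg gm.
apply: (@le_trans _ _ ((4 `^ al)%:E * ((T k)%:R `^ al)%:E)%E); last first.
  rewrite lee_pmul2l ?lte_fin ?powR_gt0//.
  exact: (Lnorm_ldiff_scale_sum_ge p1' Nw sw separated_h).
rewrite -EFinM lee_fin -powRM//; apply: ge0_ler_powR => //; rewrite ?nnegrE.
- near: t; apply: nbhs_pinfty_ge; exact: num_real.
- by rewrite mulr_ge0.
- apply: (le_trans tg); rewrite -natrM ler_nat; by case/andP: Tg.
Unshelve. all: by end_near. Qed.

End CompressionExponent.

Theorem corollary13 (R : realType) (G : topologicalGroupType)
    (hausdorff_G : hausdorff_space G)
    (locally_compact_G : locally_compact [set: G])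
    (mu : {measure set (borel G) -> \bar R}) (haar_mu : is_left_haar mu)
    (S : set G) (compact_S : compact S) (symmetric_S : symmetric_set S)
    (generates_S : generates S)
    (p : R) (p1 : (1 <= p%:E)%E) :
  (isop_exponent mu S p <=
     compression_exponent S (left_regular haar_mu (p1 := p1)))%E.
Proof.
rewrite leNgt; apply/negP => lt_ce.
move: lt_ce; set B := compression_exponent _ _ => lt_ce.
have B0 : (0 <= B)%E by apply: ereal_sup_ubound; left.
have alB_le (al : R) : 0 <= al -> (exists2 b : G -> LspaceType mu p1,
    cocycle (left_regular haar_mu (p1 :=
      p1)) b & dominates_power (compression S b) al) ->
    (al%:E <= B)%E.
  by move=> al0 Hb; apply: ereal_sup_ubound; right; exists al.
clearbody B.
(* Two reals [al < be] are inserted between [B] and the isoperimetric exponent: a cocycle with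
   exponent [al] then contradicts [B < al]. *)
have [be [beB be_lt]] : exists be : R, (B < be%:E)%E /\ (be%:E < isop_exponent
  mu S p)%E.
  case: B B0 lt_ce {alB_le} => [b b0|_|//]; last by rewrite ltNge leey.
  case: (isop_exponent mu S p) => [a| |] ba; last by rewrite ltNge leNye in ba.
    by exists ((a + b) / 2); rewrite !lte_fin in ba *; split; lra.
  by exists (b + 1); rewrite ltry lte_fin; split => //; lra.
have [al [alB al0 albe]] : exists al : R, [/\ (B < al%:E)%E, 0 <= al & al < be].
  case: B B0 beB {lt_ce alB_le} => [b|//|//]; rewrite lee_fin lte_fin => b0 bbe.
  by exists ((b + be) / 2); rewrite lte_fin; split; lra.
move: alB; rewrite ltNge => /negP; apply; apply: alB_le => //.
have [[N HN]|unb] := pselect (exists N, forall g : G,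
    (wlength symmetric_S generates_S g <= N)%N).
  exact: (compression_bounded_wlength haar_mu p1 al HN).
apply: (compression_unbounded_wlength hausdorff_G locally_compact_G haar_mu
  compact_S (symmetric_S := symmetric_S) (generates_S :=
    generates_S) p1 al0 albe) => // N.
apply: contrapT => /forallNP Ng; apply: unb; exists N => g.
by rewrite leqNgt; apply/negP; exact: Ng.
Qed.
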